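(* Let $n \ge 1$, let $\sigma \in S_n$ be a permutation of $[n]=\{1,\dots,n\}$, and let $\lambda=(\ell_1,\dots,\ell_m)$ be the partition of $n$ given by the lengths of the cycles of $\sigma$ (fixed points are cycles of length $1$). Let $\Pi_n^\sigma$ be the subset of the permutahedron $\Pi_n$ fixed by $\sigma$, and for each positive integer $t$ let $L_{\Pi_n^\sigma}(t)=|t\Pi_n^\sigma\cap\mathbb{Z}^n|$. Then $$L_{\Pi_n^\sigma}(t)=\begin{cases}\displaystyle\sum_{\pi}v_\pi\, t^{\,m-|\pi|} & \text{if } t \text{ is even, summing over all set partitions } \pi \text{ of } [m],\\[2ex] \displaystyle\sum_{\pi\ \lambda\text{-compatible}}v_\pi\, t^{\,m-|\pi|} & \text{if } t \text{ is odd, summing over all } \lambda\text{-compatible set partitions } \pi \text{ of } [m].\end{cases}$$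
   Context: The symmetric group $S_n$ acts on $\mathbb{R}^n$ by permuting coordinates. The permutahedron $\Pi_n\subset\mathbb{R}^n$ is the convex hull of the $n!$ points obtained by permuting the coordinates of $(1,2,\dots,n)$. The $2$-valuation of a positive integer is the exponent of the largest power of $2$ dividing it. A set partition $\pi=\{B_1,\dots,B_k\}$ of $[m]$ (into nonempty blocks; $|\pi|=k$) is $\lambda$-compatible if for each block $B_i$, at least one of the following holds: (i) $\ell_j$ is odd for some $j\in B_i$; (ii) the minimum $2$-valuation among $\{\ell_j: j\in B_i\}$ is attained by an even number of indices $j\in B_i$ (counted with multiplicity, i.e. over indices). For a set partition $\pi=\{B_1,\dots,B_k\}$ of $[m]$, $$v_\pi=\prod_{i=1}^k\left(\gcd(\ell_j: j\in B_i)\cdot\Big(\sum_{j\in B_i}\ell_j\Big)^{|B_i|-2}\right).$$ (For a singleton block the exponent is $-1$.) *)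

(* Defs.v *)
From HB Require Import structures.
From mathcomp Require Import all_boot all_order all_algebra all_fingroup finmap.
From mathcomp Require Import boolp classical_sets cardinality reals convex.

Set Implicit Arguments.
Unset Strict Implicit.
Unset Printing Implicit Defensive.

Import GRing.Theory Num.Theory.

Local Open Scope classical_set_scope.
Local Open Scope ring_scope.

(* Points of R^n are row vectors; indices 'I_n = {0, ..., n-1} stand for
   {1, ..., n}.  The permutation s sends x to (x_(s 0), ..., x_(s (n-1))), which
   is a left action because composition in 'S_n is (s * t) i = t (s i). *)
Definition perm_act (R : realType) (n : nat) (s : 'S_n) (x : 'rV[R]_n) :
  'rV[R]_n := col_perm s x.

Definition convex_hull (R : realType) (n : nat) (A : set 'rV[R]_n) :
  set 'rV[R]_n := smallest (@convex_set R 'rV[R]_n) A.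

Definition std_point (R : realType) (n : nat) : 'rV[R]_n :=
  \row_(i < n) i.+1%:R.

Definition permutahedron (R : realType) (n : nat) : set 'rV[R]_n :=
  convex_hull (range (fun s : 'S_n => perm_act s (std_point R n))).
Arguments permutahedron : clear implicits.

Definition fixed_permutahedron (R : realType) (n : nat) (s : 'S_n) :
  set 'rV[R]_n := [set x | permutahedron R n x /\ perm_act s x = x].
Arguments fixed_permutahedron R {n} s.

Definition dilate (R : realType) (n : nat) (t : nat) (A : set 'rV[R]_n) :
  set 'rV[R]_n := [set t%:R *: x | x in A].

Definition integer_points (R : realType) (n : nat) : set 'rV[R]_n :=
  [set x | forall i, x ord0 i \is a Num.int].
Arguments integer_points : clear implicits.

Definition lattice_points (R : realType) (n : nat) (t : nat)
  (A : set 'rV[R]_n) : set 'rV[R]_n := dilate t A `&` integer_points R n.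

(* [fset_set] is empty on infinite sets, so this is the number of lattice points
   only when [lattice_points t A] is finite. *)
Definition lattice_count (R : realType) (n : nat) (t : nat)
  (A : set 'rV[R]_n) : nat := #|` fset_set (lattice_points t A)|.

(* [porbits s] contains one set per cycle of s, fixed points included. *)
Definition cycle_type (n : nat) (s : 'S_n) : seq nat :=
  sort geq [seq #|C| | C : {set 'I_n} <- enum (porbits s)].

Section Compatible.
Variable l : seq nat.

Definition part (j : 'I_(size l)) : nat := nth 0%N l j.

Definition val2 (j : 'I_(size l)) : nat := logn 2 (part j).

Definition min_val2_indices (B : {set 'I_(size l)}) : {set 'I_(size l)} :=
  [set j in B | [forall k in B, (val2 j <= val2 k)%N]]%SET.

Definition compatible (P : {set {set 'I_(size l)}}) : bool :=
  [forall B in P,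
     [exists j in B, odd (part j)] || ~~ odd #|min_val2_indices B|].

(* The exponent #|B| - 2 is an integer, equal to -1 on singletons. *)
Definition vcoef (P : {set {set 'I_(size l)}}) : rat :=
  \prod_(B in P)
    ((\big[gcdn/0%N]_(j in B) part j)%:R
     * ((\sum_(j in B) part j)%N%:R : rat) ^ (#|B|%:Z - 2)).

End Compatible.

(* Main.v *)
Require Import Defs.
From HB Require Import structures.
From mathcomp Require Import all_boot all_order all_algebra all_fingroup finmap.
From mathcomp Require Import boolp classical_sets cardinality reals convex.
From mathcomp Require Import interval_inference zify ring lra.

(** A point fixed by the permutation is constant on its cycles. Let [z j] be the sum of
    its coordinates over the cycle [j], of length [l j]. Rado's description of the
    permutahedron ([majorization_convex]) involves only the level sets of a point
    ([level_sets_permutahedron]), which here are unions of cycles. So the lattice points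
    to be counted ([card_lattice_points]) are the integer vectors [z] such that [l j]
    divides [z j], such that the sum of [z] over any set [S] of cycles is at least [t]
    times the triangular number of the total length of [S], and such that equality holds
    for the set of all cycles. The lower bound is a sum of contributions
    [t * tri (l j)] of the cycles in [S] and [t * l i * l j] of the pairs in [S]: the
    polytope is a translated zonotope, with one segment for each edge of the complete
    graph on the cycles.

    Such points are counted by deletion and contraction
    ([card_pts_deletion_contraction]). Removing the segment of an edge of weight [w]
    between vertices of moduli [d] and [e] loses [w / lcm d e] lattice points for each
    lattice point of the projection along the edge. That projection is again of the
    same kind, for the contracted graph, with modulus [gcd d e] at the merged vertex. An
    edgeless graph has one lattice point if each modulus divides the offset of its
    vertex, and none otherwise.

    Applying this to all edges at one root vertex ([card_rooted_pts]) sorts the count by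
    the set of vertices merged with the root. The weights add up to a sum over
    spanning trees for which a closed form is available throughout ([tree_sum]): it is
    affine in the weights at the root, and deletion-contraction for it is a polynomial
    identity. For the complete graph it specializes to the power of the total length
    that Cayley's formula gives ([tree_sum_cayley]). Choosing a new root among the
    remaining vertices yields the recursion that sums over set partitions satisfy with
    respect to the block of a chosen element ([partition_sum_rec], [card_clique_pts]).

    A block survives exactly when the gcd of its lengths divides the offset, [t] times
    the sum of the triangular numbers of the lengths. Twice the offset is always
    divisible, so this is automatic for even [t]; for odd [t] it is a condition modulo a
    power of 2, and it is compatibility ([gcd_of_dvd_odd]). *)

Set Implicit Arguments.
Unset Strict Implicit.
Unset Printing Implicit Defensive.

Import Order.TTheory GRing.Theory Num.Theory.

Local Open Scope ring_scope.

(** * Triangular numbers and residue classes *)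

Section Arithmetic.
Local Open Scope nat_scope.

Definition tri (n : nat) : nat := 'C(n.+1, 2).

Lemma tri2 n : (tri n).*2 = n * n.+1.
Proof. by rewrite /tri bin2 mulnC /= -[RHS]odd_double_half oddM /= andbN. Qed.

Lemma triD m n : tri (m + n) = tri m + tri n + m * n.
Proof.
have := tri2 (m + n); have := tri2 m; have := tri2 n; rewrite -!muln2.
by move: (tri _) (tri m) (tri n) => x y z; lia.
Qed.

Lemma leq_tri : {homo tri : m n / m <= n}.
Proof. by move=> m n le_mn; rewrite -leq_double !tri2 leq_mul. Qed.

Lemma count_residue_class (h q L x0 : nat) : 0 < L ->
  \sum_(h <= x < h + q * L | x == x0 %[mod L]) 1 = q.
Proof.
move=> L0; elim: q => [|q IH]; first by rewrite mul0n addn0 big_geq.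
rewrite (@big_cat_nat _ _ _ (h + q * L)) ?leq_addr //=; last first.
  by rewrite leq_add2l leq_mul2r leqnSn orbT.
rewrite {}IH mulSn addnCA addnC.
set b := h + q * L; rewrite [L + b]addnC.
(* the representative of the class of x0 in the window [b, b + L[ *)
pose y := b + (x0 + L.-1 * b) %% L.
have yE : y = x0 %[mod L].
  by rewrite /y modnDmr addnCA -mulSn prednK // addnC mulnC modnMDl.
have yL : b <= y < b + L by rewrite leq_addr ltn_add2l ltn_pmod.
rewrite -[RHS]add1n; congr (_ + _).
rewrite -(big_filter _ (fun x => x == x0 %[mod L])).
rewrite (perm_big [:: y]) ?big_seq1 //; apply: uniq_perm => //.
  by rewrite filter_uniq ?iota_uniq.
move=> x; rewrite mem_filter mem_index_iota inE.
apply/andP/eqP => [[/eqP xE xL]|->]; last by rewrite yE eqxx yL.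
move: xL yL; wlog le_xy : x y xE yE / x <= y => [W|] xL yL.
  by case/orP: (leq_total x y) => le; [apply: W|apply/esym; apply: W].
have /eqP := etrans yE (esym xE); rewrite eqn_mod_dvd // => /dvdn_leq.
by move: xL yL le_xy; case: (posnP (y - x)); lia.
Qed.

(** A Bezout relation for [d] and [e], scaled by [s / gcdn d e], gives one solution of
    both congruences; the others differ from it by common multiples. *)
Lemma two_congruences (d e s : nat) : 0 < d -> gcdn d e %| s ->
  exists x0, forall x, (d %| x) && (x == s %[mod e]) = (x == x0 %[mod lcmn d e]).
Proof.
move=> d0 /dvdnP[j ->].
have [u v uv _] := egcdnP e d0.
have sE : u * d * j = j * gcdn d e %[mod e].
  by rewrite uv mulnDl -mulnA [e * j]mulnC mulnA modnMDl mulnC.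
exists (u * d * j) => y; rewrite -sE {sE}.
have dx0 : d %| u * d * j by rewrite mulnAC dvdn_mull.
move: (u * d * j) dx0 => x0 dx0.
wlog le_xy : y x0 dx0 / x0 <= y => [W|].
  case/orP: (leq_total x0 y) => le; first exact: W.
  have [dy|ndy] := boolP (d %| y).
    by rewrite /= eq_sym [RHS]eq_sym -(W x0 y dy le) dx0.
  apply/esym/negbTE; apply: contra ndy; rewrite eq_sym eqn_mod_dvd //.
  move/(dvdn_trans (dvdn_lcml d e)) => dd.
  by rewrite -(subKn le) dvdn_sub.
by rewrite !eqn_mod_dvd // dvdn_lcm [in RHS](dvdn_subl le_xy dx0).
Qed.

End Arithmetic.

(** * Lattice points of a base polytope *)

Section LatticePoints.
Import mathcomp.boot.fintype mathcomp.boot.finset.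
Variables (T : finType) (K : nat).
Implicit Types (U S : {set T}) (g : {set T} -> nat) (d : T -> nat) (r k : T).
Local Open Scope nat_scope.

(** The points [z] of the base polytope of the set function [g] on the ground set [U],
    with [z i] a multiple of [d i]. Nonnegative integers bounded by [K] make the type
    finite; nothing is lost when [g U <= K], because [g] takes nonnegative values and
    the coordinates add up to [g U]. *)
Definition pts U g d : {set {ffun T -> 'I_K.+1}} :=
  [set z : {ffun T -> 'I_K.+1} |
    [&& [forall i, if i \in U then d i %| z i else val (z i) == 0],
        [forall S : {set T}, (S \subset U) ==> (g S <= \sum_(i in S) z i)]
      & \sum_(i in U) z i == g U]]%SET.

Lemma ptsP U g d (z : {ffun T -> 'I_K.+1}) :
  reflect [/\ forall i, i \in U -> d i %| z i,
              forall i, i \notin U -> z i = 0 :> nat,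
              forall S, S \subset U -> g S <= \sum_(i in S) z i
            & \sum_(i in U) z i = g U]
          (z \in pts U g d).
Proof.
rewrite inE; apply: (iffP and3P) => [[/forallP dz /forallP gz /eqP zU]|[dz z0 gz zU]].
  split=> // [i iU|i /negbTE iU|S]; last by move/implyP: (gz S); apply.
  - by have := dz i; rewrite iU.
  - by have := dz i; rewrite iU => /eqP.
split; last exact/eqP.
- by apply/forallP=> i; case: ifPn => iU; [apply: dz|apply/eqP; apply: z0].
- by apply/forallP=> S; apply/implyP; apply: gz.
Qed.

Lemma eq_pts U g g' d d' :
  (forall S, S \subset U -> g S = g' S) -> {in U, d =1 d'} ->
  pts U g d = pts U g' d'.
Proof.
move=> eg ed; apply/setP=> z.
apply/ptsP/ptsP => -[dz z0 gz zU]; split=> //.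
- by move=> i iU; rewrite -ed ?dz.
- by move=> S sSU; rewrite -eg ?gz.
- by rewrite -eg.
- by move=> i iU; rewrite ed ?dz.
- by move=> S sSU; rewrite eg ?gz.
- by rewrite eg.
Qed.

(** Meant for [x <= K] only: [inord] sends larger values to 0. *)
Definition setval (z : {ffun T -> 'I_K.+1}) (i : T) (x : nat) :
    {ffun T -> 'I_K.+1} :=
  [ffun j => if j == i then inord x else z j].

Lemma setvalE z i x j : x <= K ->
  setval z i x j = (if j == i then x else z j) :> nat.
Proof. by move=> xK; rewrite ffunE; case: ifP => // _; rewrite inordK. Qed.


(** When [g] splits off [r] as a constant, the constraints on [set r] and on its
    complement squeeze the coordinate of [r] to that constant. *)
Lemma card_pts_isolated U g d r (c : nat) :
  r \in U -> g U <= K -> g set0 = 0 ->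
  (forall S, S \subset U -> r \in S -> g S = c + g (S :\ r)) ->
  #|pts U g d| = (d r %| c) * #|pts (U :\ r) g d|.
Proof.
move=> rU gK g0 gr.
have gUE : g U = c + g (U :\ r) by rewrite -gr.
have cK : c <= K by lia.
have zr z : z \in pts U g d -> z r = c :> nat.
  case/ptsP=> _ _ gz zU; have := gz [set r]; have := gz (U :\ r).
  rewrite sub1set rU subD1set big_set1 (gr [set r]) ?sub1set ?set11 // setDv g0.
  by move=> /(_ isT) H1 /(_ isT) H2; move: zU; rewrite (big_setD1 r) //=; lia.
have [dc|ndc] := boolP (d r %| c); last first.
  rewrite mul0n; apply/eqP; rewrite cards_eq0; apply/eqP/setP=> z; rewrite in_set0.
  by apply/negP => zP; case/ptsP: (zP) => /(_ r rU) + _ _ _; rewrite (zr z) // (negPf ndc).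
rewrite mul1n -[RHS](card_in_imset (f := fun z => setval z r c)); last first.
  move=> z1 z2 /ptsP[_ z1r _ _] /ptsP[_ z2r _ _] /ffunP e; apply/ffunP=> i.
  have [->|ir] := eqVneq i r.
    by apply: val_inj; rewrite /= z1r ?z2r // !inE eqxx.
  by have := e i; rewrite !ffunE (negPf ir).
apply: eq_card => z; apply/idP/imsetP => [zP|[y yP ->{z}]].
  exists (setval z r 0); last first.
    apply/ffunP=> i; apply: val_inj; rewrite /= !setvalE //.
    by case: eqP => // ->; rewrite zr.
  case/ptsP: (zP) => dz z0 gz zU; apply/ptsP; split.
  - by move=> i /setD1P[/negPf ir iU]; rewrite setvalE // ir dz.
  - by move=> i; rewrite !inE negb_and negbK setvalE //; case: eqP => //= _ /z0.
  - move=> S sSU; have rS : r \notin S.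
      apply: contraTN sSU => rS; apply/subsetPn; by exists r; rewrite // !inE eqxx.
    have sU : r |: S \subset U by rewrite subUset sub1set rU (subset_trans sSU) ?subD1set.
    have := gz _ sU; rewrite gr ?setU11 // setU1K // big_setU1 //= zr // leq_add2l.
    congr (_ <= _); apply: eq_bigr => i iS; rewrite setvalE //.
    by case: eqP => // ir; rewrite -ir iS in rS.
  - move: zU; rewrite (big_setD1 r) //= zr // gUE => /addnI <-.
    by apply: eq_bigr => i /setD1P[/negPf ir iU]; rewrite setvalE // ir.
case/ptsP: (yP) => dy y0 gy yU.
have sumD S : \sum_(i in S :\ r) setval y r c i = \sum_(i in S :\ r) y i.
  by apply: eq_bigr => i /setD1P[/negPf ir _]; rewrite setvalE // ir.
have sumr S : r \in S -> \sum_(i in S) setval y r c i = c + \sum_(i in S :\ r) y i.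
  by move=> rS; rewrite (big_setD1 r) //= setvalE // eqxx sumD.
apply/ptsP; split.
- move=> i iU; rewrite setvalE //; case: eqP => [->//|/eqP ir].
  by apply: dy; rewrite !inE ir.
- move=> i iU; rewrite setvalE //; case: eqP => [ir|_]; first by rewrite ir rU in iU.
  by apply: y0; rewrite !inE (negPf iU) andbF.
- move=> S sSU; have [rS|rS] := boolP (r \in S).
    by rewrite gr // sumr // leq_add2l gy // setSD.
  have SE : S :\ r = S by apply/setDidPl; rewrite disjoint_sym disjoints1.
  by rewrite -SE sumD gy // setSD.
- by rewrite sumr // yU gUE.
Qed.

End LatticePoints.

(** * Deletion and contraction of an edge *)

Section DeletionContraction.
Import mathcomp.boot.fintype mathcomp.boot.finset.
Variables (T : finType) (K : nat) (U : {set T}) (g : {set T} -> nat) (d : T -> nat).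
Variables (r k : T) (w : nat).
Implicit Types (S : {set T}) (y z : {ffun T -> 'I_K.+1}).
Local Open Scope nat_scope.

(** Deletion. In a sum of segments the edge between [r] and [k] contributes the segment
    from [e] times the unit vector of [r] to [e] times that of [k]; replacing this
    segment by its first end point changes the support function [g] into [raise e]. *)
Definition raise (e : nat) S := g S + (if (r \in S) && (k \notin S) then e else 0).

(** Contraction. The coordinates of [r] and [k] are added, and [r] names the merged
    vertex; the sum of a multiple of [d r] and a multiple of [d k] is an arbitrary
    multiple of their gcd. *)
Definition contract_fun S := g (if r \in S then k |: S else S).

Definition contract_mod (i : T) := if i == r then gcdn (d r) (d k) else d i.

Hypotheses (rU : r \in U) (kU : k \in U) (kr : k != r) (gK : g U <= K).
Hypothesis (dr0 : 0 < d r) (dk0 : 0 < d k) (lcm_w : lcmn (d r) (d k) %| w).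
Hypothesis supermod : forall S1 S2, S1 \subset U -> S2 \subset U ->
  k \in S1 -> r \notin S1 -> r \in S2 -> k \notin S2 ->
  g S1 + g S2 + w <= g (S1 :|: S2) + g (S1 :&: S2).

(** [z] lies in the fibre over [y] of the projection along the edge. *)
Definition merged z y :=
  [/\ z r + z k = y r, y k = 0 :> nat & forall i, i != r -> i != k -> z i = y i].

Section Merged.
Variables (z y : {ffun T -> 'I_K.+1}).
Hypothesis zy : merged z y.

Let eq_off S : r \notin S -> k \notin S -> \sum_(i in S) z i = \sum_(i in S) y i.
Proof.
case: zy => _ _ e rS kS; apply: eq_bigr => i iS; congr (val _).
by apply: e; [apply: contraNneq rS => <-|apply: contraNneq kS => <-].
Qed.

Lemma merged_sum_r S : r \in S -> k \notin S ->
  \sum_(i in S) z i = z r + \sum_(i in S :\ r) y i.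
Proof.
move=> rS kS; rewrite (big_setD1 r) //=; congr (_ + _).
by rewrite eq_off // !inE ?eqxx // negb_and kS orbT.
Qed.

Lemma merged_sum_k S : r \notin S -> k \in S ->
  \sum_(i in S) z i = z k + \sum_(i in S) y i.
Proof.
case: zy => _ yk _ rS kS; rewrite !(big_setD1 k kS) /= yk add0n; congr (_ + _).
by rewrite eq_off // !inE ?eqxx // negb_and rS orbT.
Qed.

Lemma merged_sum S : (r \in S) = (k \in S) ->
  \sum_(i in S) z i = \sum_(i in S) y i.
Proof.
case: zy => yr yk _; have [rS|rS] := boolP (r \in S) => kS; last by rewrite eq_off // -kS.
have kSr : k \in S :\ r by rewrite !inE kr -kS.
rewrite !(big_setD1 r rS) /= !(big_setD1 k kSr) /= yk add0n addnA yr; congr (_ + _).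
by rewrite eq_off // !inE ?eqxx ?andbF.
Qed.

Lemma merged_pts : z \in pts K U g d -> y \in pts K (U :\ k) contract_fun contract_mod.
Proof.
case: (zy) => yr yk yi /ptsP[dz z0 gz zU].
have rUk : r \in U :\ k by rewrite !inE eq_sym kr.
apply/ptsP; split.
- move=> i /setD1P[ik iU]; rewrite /contract_mod; case: eqP => [->|/eqP ir].
    rewrite -yr dvdn_add //.
      exact: dvdn_trans (dvdn_gcdl _ _) (dz r rU).
    exact: dvdn_trans (dvdn_gcdr _ _) (dz k kU).
  by rewrite -yi ?dz.
- move=> i; rewrite !inE negb_and negbK; have [->//|ik /= iU] := eqVneq i k.
  by rewrite -yi ?z0 //; apply: contraNneq iU => ->.
- move=> S sSU; have kS : k \notin S.
    by apply/negP => /(subsetP sSU); rewrite !inE eqxx.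
  have sS : S \subset U by rewrite (subset_trans sSU) ?subD1set.
  rewrite /contract_fun; case: ifPn => rS; last first.
    by rewrite -merged_sum ?gz // (negPf rS) (negPf kS).
  have -> : \sum_(i in S) y i = \sum_(i in k |: S) y i.
    by rewrite big_setU1 //= yk.
  rewrite -merged_sum ?gz ?subUset ?sub1set ?kU //.
  by rewrite !inE rS eqxx orbT.
- rewrite /contract_fun rUk setD1K // -zU merged_sum ?rU ?kU //.
  by rewrite [in RHS](big_setD1 k) //= yk.
Qed.

End Merged.

Section Fibre.
Variable y : {ffun T -> 'I_K.+1}.
Hypothesis yP : y \in pts K (U :\ k) contract_fun contract_mod.

Let yk : y k = 0 :> nat.
Proof. by case/ptsP: yP => _ + _ _; apply; rewrite !inE eqxx. Qed.

(** The least value allowed to the coordinate of [r] by the constraints separating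
    [r] from [k]. *)
Lemma fibre_lower_bound : exists h,
  (forall S, S \subset U -> r \in S -> k \notin S -> g S <= h + \sum_(i in S :\ r) y i) /\
  (exists S, [/\ S \subset U, r \in S, k \notin S & g S = h + \sum_(i in S :\ r) y i]).
Proof.
pose A := [set S : {set T} | [&& S \subset U, r \in S & k \notin S]].
pose F S := g S - \sum_(i in S :\ r) y i.
have A1 : [set r] \in A by rewrite !inE sub1set rU eqxx.
have [|S0 S0A maxE] := @eq_bigmax_cond _ (mem A) F; first by apply/card_gt0P; exists [set r].
have le_max S : S \in A -> F S <= F S0.
  by move=> SA; rewrite -maxE; apply: leq_bigmax_cond.
exists (F S0); split=> [S sSU rS kS|].
  by rewrite addnC -leq_subLR le_max // !inE sSU rS kS.
have [lt|ge] := ltnP (g S0) (\sum_(i in S0 :\ r) y i).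
  (* the maximum is then 0, and it is also attained at the singleton of r *)
  have := le_max _ A1; rewrite /F setDv big_set0 subn0.
  have -> : g S0 - \sum_(i in S0 :\ r) y i = 0 by lia.
  rewrite leqn0 => /eqP gr; exists [set r]; split; rewrite ?sub1set ?set11 ?inE //.
  by rewrite setDv big_set0.
exists S0; move: S0A; rewrite inE => /and3P[-> -> ->]; split=> //.
by rewrite /F subnK.
Qed.

Variable h : nat.
Hypothesis h_ge : forall S, S \subset U -> r \in S -> k \notin S ->
  g S <= h + \sum_(i in S :\ r) y i.
Hypothesis h_eq : exists S,
  [/\ S \subset U, r \in S, k \notin S & g S = h + \sum_(i in S :\ r) y i].

(** Supermodularity, applied to [S] and to a set attaining the lower bound [h], leaves
    constraints on the union and the intersection, which do not separate [r] from [k]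
    and hold for [y]. So the fibre over [y] is an interval of length at least [w]. *)
Lemma fibre_upper_bound S : S \subset U -> k \in S -> r \notin S ->
  g S + (h + w) <= y r + \sum_(i in S) y i.
Proof.
move=> sSU kS rS; have [S0 [sS0 rS0 kS0 gS0]] := h_eq.
have := supermod sSU sS0 kS rS rS0 kS0; rewrite gS0.
case/ptsP: yP => _ _ gy _.
have HI : g (S :&: S0) <= \sum_(i in S :&: S0) y i.
  have := gy (S :&: S0); rewrite /contract_fun inE (negPf rS) /=; apply.
  by rewrite subsetD1 inE (negPf kS0) andbF (subset_trans (subsetIl _ _)).
have HU : g (S :|: S0) <= \sum_(i in S :|: S0) y i.
  have := gy ((S :|: S0) :\ k); rewrite /contract_fun !inE eq_sym kr rS0 orbT /=.
  rewrite setD1K ?inE ?kS // [in X in _ -> X](big_setD1 k) ?inE ?kS //= yk; apply.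
  by rewrite setSD // subUset sSU.
have modular : \sum_(i in S :|: S0) y i + \sum_(i in S :&: S0) y i =
    \sum_(i in S) y i + (y r + \sum_(i in S0 :\ r) y i).
  rewrite -(big_setD1 r rS0) /= (big_setID S) /= [in RHS]addnC.
  rewrite [X in _ = X + _](big_setID S) /= setUK setDUl setDv set0U [S0 :&: S]setIC.
  by rewrite addnC addnCA addnC.
move: HI HU modular; clear; lia.
Qed.

Lemma mem_pts_raise e z : e <= w -> merged z y ->
  (z \in pts K U (raise e) d) <->
  [/\ d r %| z r, d k %| z k, h + e <= z r &
      forall S, S \subset U -> k \in S -> r \notin S -> g S <= z k + \sum_(i in S) y i].
Proof.
move=> le_ew zy; case: (zy) => zr _ zi; split.
  case/ptsP=> dz z0 gz zU; split; rewrite ?dz //.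
    have [S0 [sS0 rS0 kS0 gS0]] := h_eq.
    have := gz _ sS0; rewrite /raise rS0 kS0 /= (merged_sum_r zy) // gS0.
    by rewrite addnAC leq_add2r.
  move=> S sS kS rS; have := gz _ sS.
  by rewrite /raise (negPf rS) /= addn0 (merged_sum_k zy).
case=> dr dk hz Sz; case/ptsP: (yP) => dy y0 gy yU.
have rUk : r \in U :\ k by rewrite !inE eq_sym kr.
have sum_k S : \sum_(i in S :\ k) y i = \sum_(i in S) y i.
  have [kS|kS] := boolP (k \in S); first by rewrite [RHS](big_setD1 k) //= yk.
  by apply: eq_bigl => i; rewrite !inE; case: eqP => // ->; rewrite (negPf kS).
apply/ptsP; split.
- move=> i iU; have [->//|ir] := eqVneq i r; have [->//|ik] := eqVneq i k.
  have := dy i; rewrite /contract_mod (negPf ir) !inE ik iU zi //; exact.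
- move=> i iU; rewrite zi; first by apply: y0; rewrite !inE (negPf iU) andbF.
    by apply: contraNneq iU => ->.
  by apply: contraNneq iU => ->.
- move=> S sS; rewrite /raise.
  have [rS|rS] := boolP (r \in S); have [kS|kS] := boolP (k \in S) => /=.
  + rewrite addn0 (merged_sum zy) ?rS ?kS // -sum_k.
    have := gy (S :\ k); rewrite /contract_fun !inE eq_sym kr rS /= setD1K //; apply.
    by rewrite setSD.
  + rewrite (merged_sum_r zy) //; have := h_ge sS rS kS.
    by move=> gS; apply: leq_trans (leq_add gS (leqnn e)) _; rewrite addnAC leq_add2r.
  + by rewrite addn0 (merged_sum_k zy) // Sz.
  + rewrite addn0 (merged_sum zy) ?(negPf rS) ?(negPf kS) //.
    have := gy S; rewrite /contract_fun (negPf rS); apply.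
    by rewrite subsetD1 sS.
- rewrite /raise rU kU addn0 (merged_sum zy) ?rU ?kU // -sum_k yU.
  by rewrite /contract_fun rUk setD1K.
Qed.

End Fibre.


Definition merge z := setval (setval z r (z r + z k)) k 0.

Lemma mergeP z : z \in pts K U g d -> merged z (merge z).
Proof.
case/ptsP=> _ _ _ zU.
have zK : z r + z k <= K.
  apply: leq_trans gK; rewrite -zU (big_setD1 r) //= leq_add2l.
  by rewrite (big_setD1 k) ?inE ?kr //= leq_addr.
split=> [||i ir ik]; rewrite /merge.
- by rewrite setvalE // eq_sym (negPf kr) setvalE // eqxx.
- by rewrite setvalE // eqxx.
- by rewrite !ffunE (negPf ir) (negPf ik).
Qed.

Lemma merged_inj z y y' : merged z y -> merged z y' -> y = y'.
Proof.
move=> [r1 k1 e1] [r2 k2 e2]; apply/ffunP=> i; apply: val_inj => /=.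
have [->|ir] := eqVneq i r; first by rewrite -r1 -r2.
have [->|ik] := eqVneq i k; first by rewrite k1 k2.
by rewrite -e1 // -e2.
Qed.

Definition unmerge y x := setval (setval y r x) k (y r - x).

Lemma unmergeP y x : y k = 0 :> nat -> x <= y r -> merged (unmerge y x) y.
Proof.
move=> yk xy; have yK : y r <= K by rewrite -ltnS.
have xK : x <= K := leq_trans xy yK.
split=> // [|i ir ik]; last by rewrite !ffunE (negPf ir) (negPf ik).
rewrite /unmerge !setvalE // ?(leq_trans (leq_subr _ _)) // !eqxx eq_sym (negPf kr).
by rewrite subnKC.
Qed.

Lemma unmerge_r y x : x <= y r -> unmerge y x r = x :> nat.
Proof.
move=> xy; have yK : y r <= K by rewrite -ltnS.
rewrite /unmerge setvalE ?(leq_trans (leq_subr _ _)) // eq_sym (negPf kr).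
by rewrite setvalE ?eqxx // (leq_trans xy).
Qed.

Let D := pts K U g d :\: pts K U (raise w) d.

(** The coordinate of [r] ranges over the integers of [[h, h + w[] that satisfy both
    divisibility conditions, which is one residue class modulo the lcm. *)
Lemma card_fibre y : y \in pts K (U :\ k) contract_fun contract_mod ->
  #|[set z in D | merge z == y]| = w %/ lcmn (d r) (d k).
Proof.
move=> yP; have [h [h_ge h_eq]] := fibre_lower_bound yP.
case/ptsP: (yP) => dy y0 gy yU.
have yk : y k = 0 :> nat by apply: y0; rewrite !inE eqxx.
have hw : h + w <= y r.
  have rk : r \notin [set k] by rewrite inE eq_sym.
  have := fibre_upper_bound yP h_eq (S := [set k]).
  by rewrite sub1set kU set11 rk big_set1 yk => /(_ isT isT isT); lia.
pose P x := [&& h <= x < h + w, d r %| x & x == y r %[mod d k]].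
have le_Px (x : 'I_K.+1) : P x -> x <= y r.
  by rewrite /P => /andP[/andP[_ /ltnW le] _]; apply: leq_trans hw.
have mem_D z : merged z y -> (z \in D) = P (z r).
  move=> zy; case: (zy) => zr _ _; rewrite inE.
  have -> : pts K U g d = pts K U (raise 0) d.
    by apply: eq_pts => // S _; rewrite /raise if_same addn0.
  have H0 := mem_pts_raise yP h_ge h_eq (leq0n w) zy.
  have Hw := mem_pts_raise yP h_ge h_eq (leqnn w) zy.
  have dkE : (val (z r) == y r %[mod d k]) = (d k %| z k).
    by rewrite eq_sym -zr eqn_mod_dvd ?leq_addr // addKn.
  rewrite addn0 in H0; apply/andP/and3P => [[/negP nw /H0 [dr dk hz Sz]]|].
    rewrite dkE dr dk hz /=; split=> //; rewrite ltnNge; apply/negP => ge.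
    by apply: nw; apply/Hw; split.
  rewrite dkE => -[/andP[hz zh] dr dk]; split.
    by apply/negP => /Hw[_ _]; rewrite leqNgt zh.
  apply/H0; split=> // S sS kS rS.
  have := fibre_upper_bound yP h_eq sS kS rS; rewrite -zr => le.
  rewrite -(leq_add2r (z r)) addnAC [z k + _]addnC; apply: leq_trans le.
  by rewrite leq_add2l ltnW.
have -> : [set z in D | merge z == y] =
    [set unmerge y (val x) | x in [set x : 'I_K.+1 | P x]].
  apply/setP=> z; apply/idP/imsetP.
    rewrite inE => /andP[zD /eqP mz]; exists (z r).
      rewrite inE -mem_D // -mz; apply: mergeP.
      by move: zD; rewrite inE => /andP[].
    have zy : merged z y by rewrite -mz; apply: mergeP; move: zD; rewrite inE => /andP[].
    case: (zy) => zr _ zi; apply/ffunP=> i; apply: val_inj => /=.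
    have [-> |ir] := eqVneq i r; first by rewrite unmerge_r // -zr leq_addr.
    have [-> |ik] := eqVneq i k.
      rewrite /unmerge setvalE ?eqxx -?zr ?addKn //.
      by rewrite -ltnS.
    by rewrite zi // !ffunE (negPf ir) (negPf ik).
  case=> x xP ->; have Px : P x by move: xP; rewrite inE.
  have xy := le_Px _ Px.
  have zy := unmergeP yk xy.
  have zD : unmerge y x \in D by rewrite mem_D // unmerge_r.
  rewrite inE zD; apply/eqP/(@merged_inj (unmerge y x)) => //; apply: mergeP.
  by move: zD; rewrite inE => /andP[].
rewrite card_in_imset; last first.
  move=> x1 x2; rewrite !inE => /le_Px le1 /le_Px le2 e; apply: val_inj => /=.
  by rewrite -(unmerge_r le1) e unmerge_r.
have gcd_y : gcdn (d r) (d k) %| y r.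
  by have := dy r; rewrite !inE eq_sym kr rU /contract_mod eqxx; apply.
have [x0 x0E] := two_congruences dr0 gcd_y.
have L0 : 0 < lcmn (d r) (d k) by rewrite lcmn_gt0 dr0.
rewrite -[RHS](count_residue_class h _ x0 L0) divnK //.
have hwK : h + w <= K.+1 by rewrite (leq_trans hw) // ltnW.
rewrite (big_nat_widen _ _ K.+1) // (big_nat_widenl _ 0) // big_mkord -sum1_card.
apply: eq_bigl => x; rewrite inE /P -x0E.
by case: (h <= x); case: (x < h + w); rewrite ?andbT ?andbF.
Qed.

(** Deleting an edge of weight [w] shortens the polytope by a half-open segment of
    length [w] on every line parallel to the edge. The lines that carry a lattice point
    and meet the polytope are the lattice points of the contraction, and each loses
    the points of [w %/ lcmn (d r) (d k)] periods. *)
Lemma card_pts_deletion_contraction :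
  #|pts K U g d| = #|pts K U (raise w) d|
    + w %/ lcmn (d r) (d k) * #|pts K (U :\ k) contract_fun contract_mod|.
Proof.
have sub : pts K U (raise w) d \subset pts K U g d.
  apply/subsetP=> z /ptsP[dz z0 gz zU]; apply/ptsP; split=> //.
    by move=> S /gz; apply: leq_trans; apply: leq_addr.
  by rewrite zU /raise rU kU addn0.
rewrite -(cardsID (pts K U (raise w) d)) (setIidPr sub) -/D; congr (_ + _).
rewrite -sum1_card (partition_big merge (mem (pts K (U :\ k) contract_fun contract_mod))).
  rewrite mulnC -sum_nat_const; apply: eq_bigr => y yP.
  by rewrite -(card_fibre yP) -sum1_card; apply: eq_bigl => z; rewrite inE.
move=> z; rewrite inE => /andP[_ zP]; exact: merged_pts (mergeP zP) zP.
Qed.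

End DeletionContraction.

(** * Counting with a root *)

Section RootedCount.
Import mathcomp.boot.fintype mathcomp.boot.finset.
Variables (T : finType) (K : nat) (a : T -> nat) (t : nat).
Hypothesis a_gt0 : forall i, (0 < a i)%N.
Implicit Types (U V S B : {set T}) (u : T -> nat) (r k : T).

Definition mass S : nat := (\sum_(i in S) a i)%N.

Definition gcd_of S : nat := \big[gcdn/0%N]_(i in S) a i.

(** By [triD] this is [t * tri (a i)] summed over the vertices of [S] plus
    [t * a i * a j] summed over the pairs in [S]: the support function of a translated
    zonotope of the complete graph with edge weights [t * a i * a j]. *)
Definition clique_fun S : nat := (t * tri (mass S))%N.

(** The same graph with an additional vertex [r] of offset [c], joined to [i] by an edge
    of weight [t * a i * u i]. Deleting or contracting an edge at [r] only changes [c]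
    and [u], so this family is closed under both operations. *)
Definition rooted_fun r (c : nat) u S : nat :=
  (clique_fun (S :\ r)
   + (if r \in S then c + t * \sum_(i in S :\ r) a i * u i else 0))%N.

Definition root_mod r (d : nat) (i : T) : nat := if i == r then d else a i.

Definition kill k u (i : T) : nat := if i == k then 0%N else u i.

Lemma mass_split S i : i \in S -> mass S = (a i + mass (S :\ i))%N.
Proof. by move=> iS; rewrite /mass (big_setD1 i). Qed.

(** The edge between [k] and [r] lies in the union but in neither of the two sets. *)
Lemma rooted_fun_supermod r c u k S1 S2 :
  k \in S1 -> r \notin S1 -> r \in S2 -> k \notin S2 ->
  (rooted_fun r c u S1 + rooted_fun r c u S2 + t * a k * u k
   <= rooted_fun r c u (S1 :|: S2) + rooted_fun r c u (S1 :&: S2))%N.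
Proof.
move=> kS1 rS1 rS2 kS2; rewrite /rooted_fun !inE rS2 (negPf rS1) orbT /= !addn0.
have kr : k != r by apply: contraNneq rS1 => <-.
have S1r S : r \notin S -> S :\ r = S by move=> ?; apply/setDidPl; rewrite disjoint_sym disjoints1.
rewrite (S1r S1) // (S1r (S1 :&: S2)); last by rewrite inE (negPf rS1).
rewrite setDUl (S1r S1) //; set S3 := S2 :\ r.
have -> : S1 :&: S2 = S1 :&: S3.
  by apply/setP=> i; rewrite !inE; case: eqP => // ->; rewrite (negPf rS1).
have kS3 : k \notin S3 by rewrite inE (negPf kS2) andbF.
have sumU (F : T -> nat) :
    (\sum_(i in S1 :|: S3) F i = \sum_(i in S1 :\: S3) F i + \sum_(i in S3) F i)%N.
  rewrite (big_setID S3) /= setIUl setIid setDUl setDv setU0 addnC.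
  by rewrite (setUidPr (subsetIr _ _)).
have mU : mass (S1 :|: S3) = (mass (S1 :\: S3) + mass S3)%N := sumU _.
have m1 : mass S1 = (mass (S1 :&: S3) + mass (S1 :\: S3))%N by rewrite /mass (big_setID S3).
have m3 : mass S3 = (mass (S1 :&: S3) + mass (S3 :\: S1))%N.
  by rewrite /mass (big_setID S1) /= setIC.
have w : (a k * u k <= \sum_(i in S1 :\: S3) a i * u i)%N.
  by rewrite (big_setD1 k) ?leq_addr // inE kS1 kS3.
rewrite /clique_fun mU sumU m1 m3 !triD.
move: (tri _) (tri _) (tri _) w => p q v; move: (\sum_(i in _) _)%N => x w.
move: (\sum_(i in _) _)%N => y; nia.
Qed.

Lemma raise_rooted_fun r c u k S : k != r ->
  raise (rooted_fun r c u) r k (t * a k * u k) S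
  = rooted_fun r (c + t * a k * u k) (kill k u) S.
Proof.
move=> kr; rewrite /raise /rooted_fun -addnA; congr addn.
case: (boolP (r \in S)) => rS //=; have [kS|kS] := boolP (k \in S) => /=.
  have kSr : k \in S :\ r by rewrite !inE kr kS.
  rewrite addn0 !(big_setD1 k kSr) /= /kill eqxx muln0 add0n mulnDr -!addnA mulnA.
  congr (_ + (_ + t * _))%N; apply: eq_bigr => i /setD1P[/negPf ik _].
  by rewrite ik.
rewrite -!addnA [X in (_ + X)%N]addnC; congr (_ + (_ + t * _))%N.
apply: eq_bigr => i /setD1P[_ iS]; rewrite /kill; case: eqP => // ik.
by rewrite -ik iS in kS.
Qed.

Lemma contract_rooted_fun r c u k S : k != r -> k \notin S ->
  contract_fun (rooted_fun r c u) r k S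
  = rooted_fun r (c + t * tri (a k) + t * a k * u k) (fun i => u i + a k)%N S.
Proof.
move=> kr kS; rewrite /contract_fun /rooted_fun /clique_fun.
case: (boolP (r \in S)) => rS; last first.
  by rewrite (negPf rS).
rewrite !inE rS orbT.
have -> : (k |: S) :\ r = k |: (S :\ r).
  by rewrite setDUl; congr setU; apply/setDidPl; rewrite disjoints1 inE.
have kSr : k \notin S :\ r by rewrite inE (negPf kS) andbF.
have -> : mass (k |: (S :\ r)) = (a k + mass (S :\ r))%N by rewrite /mass big_setU1.
have -> : (\sum_(i in k |: (S :\ r)) a i * u i
    = a k * u k + \sum_(i in S :\ r) a i * u i)%N by rewrite big_setU1.
have -> : (\sum_(i in S :\ r) a i * (u i + a k)
    = \sum_(i in S :\ r) a i * u i + a k * mass (S :\ r))%N.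
  by rewrite /mass big_distrr -big_split; apply: eq_bigr => i _ /=; lia.
by rewrite triD; nia.
Qed.

(** [t ^ #|B| * tree_sum B u] is the weighted number of spanning trees on the root and
    [B], up to the product of the lengths: an edge between [i] and [j] weighs
    [t * a i * a j] and an edge between the root and [i] weighs [t * a i * u i], and
    the factors [a i] for [i] in [B] are dropped. *)
Definition tree_sum B u : rat :=
  \prod_(i in B) (mass B + u i)%:R
  - \sum_(i in B) (a i)%:R * \prod_(j in B :\ i) (mass B + u j)%:R.

Lemma tree_sum0 u : tree_sum set0 u = 1.
Proof. by rewrite /tree_sum !big_set0 subr0. Qed.

Lemma eq_tree_sum B u u' : {in B, u =1 u'} -> tree_sum B u = tree_sum B u'.
Proof.
move=> e; congr (_ - _); first by apply: eq_bigr => i /e ->.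
by apply: eq_bigr => i _; congr (_ * _); apply: eq_bigr => j /setD1P[_ /e ->].
Qed.

(** Both terms of [tree_sum] are affine in [u k], and contracting [k] keeps
    [mass B + u i] unchanged. *)
Lemma tree_sum_deletion_contraction B u k : k \in B ->
  tree_sum B u = tree_sum B (kill k u)
                 + (u k)%:R * tree_sum (B :\ k) (fun i => u i + a k)%N.
Proof.
move=> kB; rewrite /tree_sum.
have mE i : (mass (B :\ k) + (u i + a k) = mass B + u i)%N.
  by rewrite (mass_split kB); lia.
under [X in _ = _ + _ * (X - _)]eq_bigr => i _ do rewrite mE.
under [X in _ = _ + _ * (_ - X)]eq_bigr => i _ do
  under eq_bigr => j _ do rewrite mE.
rewrite !(big_setD1 k kB) /=.
set P := \prod_(i in B :\ k) (mass B + u i)%:R.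
have -> : \prod_(i in B :\ k) (mass B + kill k u i)%:R = P.
  by apply: eq_bigr => i /setD1P[/negPf ik _]; rewrite /kill ik.
pose Q i : rat := \prod_(j in B :\ k :\ i) (mass B + u j)%:R.
have sumE (v : T -> nat) : (forall j, j != k -> v j = u j) ->
    \sum_(i in B :\ k) (a i)%:R * \prod_(j in B :\ i) (mass B + v j)%:R
    = (mass B + v k)%:R * \sum_(i in B :\ k) (a i)%:R * Q i.
  move=> vu; rewrite big_distrr; apply: eq_bigr => i /setD1P[ik iB] /=.
  rewrite (big_setD1 k) ?inE ?kB 1?eq_sym ?ik //= mulrCA; congr (_ * (_ * _)).
  have -> : B :\ i :\ k = B :\ k :\ i by rewrite !setDDl setUC.
  by apply: eq_bigr => j; rewrite !inE => /and3P[_ jk _]; rewrite vu.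
rewrite (sumE u) // (sumE (kill k u)); last by move=> j /negPf jk; rewrite /kill jk.
rewrite /kill eqxx addn0 !natrD.
by move: (\sum_(i in _) _) P => X P; ring.
Qed.

Lemma tree_sum_null B u : {in B, forall i, u i = 0%N} -> B != set0 -> tree_sum B u = 0.
Proof.
move=> u0 B0; rewrite (@eq_tree_sum B u (fun=> 0%N)) ?/tree_sum //.
under eq_bigr do rewrite addn0.
under [X in _ - X]eq_bigr => i iB.
  under eq_bigr do rewrite addn0.
  rewrite prodr_const; over.
rewrite -card_gt0 in B0; rewrite prodr_const.
have cB i : i \in B -> #|B :\ i| = #|B|.-1 by move=> iB; rewrite (cardsD1 i B) iB.
under [X in _ - X]eq_bigr => i iB do rewrite cB //.
by rewrite -big_distrl /= -natr_sum -/(mass B) -exprS prednK // subrr.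
Qed.

(** Cayley's formula for weighted trees: the root behaves as a vertex of length [s] of
    the complete graph. Multiplying by the total length makes the case of an empty [B]
    uniform with the others. *)
Lemma tree_sum_cayley B s :
  tree_sum B (fun=> s) * (mass B + s)%:R = s%:R * (mass B + s)%:R ^+ #|B|.
Proof.
rewrite /tree_sum prodr_const mulrBl mulr_suml.
have -> : \sum_(i in B) (a i)%:R * \prod_(j in B :\ i) (mass B + s)%:R * (mass B + s)%:R
    = \sum_(i in B) (a i)%:R * (mass B + s)%:R ^+ #|B| :> rat.
  apply: eq_bigr => i iB.
  by rewrite prodr_const -mulrA -exprSr (cardsD1 i B) iB.
rewrite -big_distrl /= -natr_sum -/(mass B) natrD; ring.
Qed.

Definition block_mod d B := gcdn d (gcd_of B).

Definition rooted_summand V (d c : nat) u B : rat :=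
  (block_mod d B %| c + t * \sum_(i in B) tri (a i))%N%:R
  * (block_mod d B)%:R / d%:R * t%:R ^+ #|B| * tree_sum B u
  * #|pts K (V :\: B) clique_fun a|%:R.

Lemma big_subset_split V k (F : {set T} -> rat) : k \in V ->
  \sum_(B : {set T} | B \subset V) F B
  = \sum_(B : {set T} | B \subset V :\ k) (F B + F (k |: B)).
Proof.
move=> kV; rewrite (bigID (fun B : {set T} => k \in B)) /= addrC big_split /=.
congr (_ + _); first by apply: eq_bigl => B; rewrite subsetD1.
rewrite (reindex_onto (fun B => k |: B) (fun B => B :\ k)) /=; last first.
  by move=> B /andP[_ kB]; rewrite setD1K.
apply: eq_bigl => B; rewrite setU11 andbT subsetD1 subUset sub1set kV /=.
congr (_ && _); apply/eqP/idP => [<-|kB]; first by rewrite !inE eqxx.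
by rewrite setU1K.
Qed.

(** Deleting or contracting the edges at the root one by one ends with an isolated root
    that has absorbed some set [B] of vertices. [tree_sum] gathers the weights of all
    ways to absorb [B], and the divisibility condition is what an isolated root leaves.
    The measure of the induction decreases because a deletion removes an edge at the
    root and a contraction removes a vertex. *)
Theorem card_rooted_pts V r d c u :
  r \notin V -> (0 < d)%N -> {in V, forall i, d %| u i}%N ->
  (rooted_fun r c u (r |: V) <= K)%N ->
  #|pts K (r |: V) (rooted_fun r c u) (root_mod r d)|%:R
  = \sum_(B : {set T} | B \subset V) rooted_summand V d c u B.
Proof.
have [n] := ubnP (#|V| * #|T|.+1 + #|[set i in V | u i != 0%N]|)%N.
elim: n => // n IH in V d c u *; rewrite ltnS => le_n rV d0 du leK.
have [k kP|u0] := pickP [pred i in V | u i != 0%N]; last first.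
  have {}u0 i : i \in V -> u i = 0%N by move=> iV; have := u0 i; rewrite inE iV => /negbFE/eqP.
  rewrite (bigD1 set0) ?sub0set //= [X in _ + X]big1 ?addr0; last first.
    move=> B /andP[sBV B0]; rewrite /rooted_summand tree_sum_null ?mulr0 ?mul0r //.
    by move=> i /(subsetP sBV)/u0.
  rewrite (@card_pts_isolated _ _ _ _ _ r c) ?setU11 //; first last.
  - move=> S sS rS; rewrite /rooted_fun rS setDDl setUid !inE eqxx /= addn0.
    rewrite big1 ?muln0 ?addn0 1?addnC // => i /setD1P[ir /(subsetP sS)].
    by rewrite !inE (negPf ir) => /u0 ->; rewrite muln0.
  - by rewrite /rooted_fun inE set0D /clique_fun /mass big_set0 muln0.
  rewrite /rooted_summand tree_sum0 setD0 /block_mod /gcd_of !big_set0 gcdn0 muln0 addn0.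
  rewrite setU1K // natrM cards0 expr0 !mulr1 mulfK ?pnatr_eq0 -?lt0n // /root_mod eqxx.
  congr (_ * _%:R); rewrite (@eq_pts _ _ _ _ clique_fun _ a) // => [S sSV|i iV].
    have rS : r \notin S by apply: contra rV => /(subsetP sSV).
    rewrite /rooted_fun (negPf rS) addn0; congr clique_fun.
    by apply/setDidPl; rewrite disjoint_sym disjoints1.
  by rewrite /=; case: eqP => // ir; rewrite -ir iV in rV.
case/andP: kP => /= kV uk0; pose w := (t * a k * u k)%N.
have kr : k != r by apply: contraNneq rV => <-.
have kU : k \in r |: V by rewrite !inE kV orbT.
have lcm_w : (lcmn d (a k) %| w)%N.
  by rewrite dvdn_lcm /w dvdn_mull ?du // mulnAC dvdn_mull.
pose q := (w %/ lcmn d (a k))%N.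
have qE : (q * d = t * u k * gcdn d (a k))%N.
  apply/eqP; rewrite -(eqn_pmul2r (a_gt0 k)) -!mulnA -[(d * a k)%N]muln_lcm_gcd.
  by rewrite mulnA divnK // /w; apply/eqP; lia.
set u1 := fun i => (u i + a k)%N; pose c1 := (c + t * tri (a k) + w)%N.
have rmk : root_mod r d k = a k by rewrite /root_mod (negPf kr).
have rmr : root_mod r d r = d by rewrite /root_mod eqxx.
have contrE S : k \notin S -> contract_fun (rooted_fun r c u) r k S = rooted_fun r c1 u1 S.
  exact: contract_rooted_fun.
rewrite (@card_pts_deletion_contraction _ _ _ _ _ r k w) ?setU11 ?rmk ?rmr //; last first.
  by move=> S1 S2 _ _; apply: rooted_fun_supermod.
have -> : (r |: V) :\ k = r |: (V :\ k).
  by rewrite setDUl; congr setU; apply/setDidPl; rewrite disjoints1 inE eq_sym.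
rewrite (@eq_pts _ _ _ (raise _ r k w) (rooted_fun r (c + w) (kill k u)) _ (root_mod r d)) //;
  last by move=> S _; apply: raise_rooted_fun.
rewrite (@eq_pts _ _ _ (contract_fun _ r k) (rooted_fun r c1 u1) _ (root_mod r (gcdn d (a k))));
  first last.
- by move=> i _; rewrite /contract_mod rmk rmr /root_mod; case: eqP.
- by move=> S sS; apply: contrE; apply/negP => /(subsetP sS); rewrite !inE eqxx (negPf kr).
rewrite -/q natrD natrM.
rewrite (IH V d (c + w)%N (kill k u)) //; last 3 first.
- apply: leq_trans le_n; rewrite ltn_add2l [X in (_ < X)%N](cardsD1 k) !inE kV uk0 add1n ltnS.
  by apply/subset_leq_card/subsetP => i; rewrite !inE /kill; case: (i =P k); rewrite ?andbF.
- by move=> i /du; rewrite /kill; case: eqP.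
- by rewrite -raise_rooted_fun // /raise setU11 kU addn0.
have kVk : k \notin r |: (V :\ k) by rewrite !inE eqxx (negPf kr).
rewrite (IH (V :\ k) (gcdn d (a k)) c1 u1) //; last 5 first.
- apply: leq_trans le_n; rewrite [#|V|](cardsD1 k) kV add1n mulSn.
  by have := max_card [set i in V :\ k | u1 i != 0%N]; move: (_ * _)%N; lia.
- by rewrite inE (negPf rV) andbF.
- by rewrite gcdn_gt0 d0.
- move=> i /setD1P[_ /du di]; rewrite dvdn_add ?dvdn_gcdr //.
  exact: dvdn_trans (dvdn_gcdl _ _) di.
- rewrite -contrE // /contract_fun setU11 setUCA setD1K //.
rewrite big_distrr /= !(big_subset_split _ kV) -big_split /=; apply: eq_bigr => B.
rewrite subsetD1 => /andP[sBV kB].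
have block_k : block_mod (gcdn d (a k)) B = block_mod d (k |: B).
  by rewrite /block_mod /gcd_of big_setU1 //= gcdnA.
have indE S x : (block_mod d S %| c + w + x)%N = (block_mod d S %| c + x)%N.
  rewrite -addnA addnCA dvdn_addr // /w dvdn_mull //.
  exact: dvdn_trans (dvdn_gcdl _ _) (du k kV).
have indE1 : (block_mod d (k |: B) %| c1 + t * \sum_(i in B) tri (a i))%N
    = (block_mod d (k |: B) %| c + t * \sum_(i in k |: B) tri (a i))%N.
  rewrite big_setU1 //= -indE /c1; congr (_ %| _)%N; lia.
rewrite /rooted_summand !indE block_k indE1 setDDl.
rewrite (@eq_tree_sum B (kill k u) u); last first.
  by move=> i iB; rewrite /kill; case: eqP => // ik; rewrite -ik iB in kB.
rewrite (@tree_sum_deletion_contraction (k |: B) u k) ?setU11 // setU1K //.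
rewrite -addrA; congr (_ + _); rewrite cardsU1 kB add1n.
have qE' : q%:R = t%:R * (u k)%:R * (gcdn d (a k))%:R / d%:R :> rat.
  by rewrite -!natrM -qE natrM mulfK // pnatr_eq0 -lt0n.
have g0 : (gcdn d (a k))%:R != 0 :> rat by rewrite pnatr_eq0 -lt0n gcdn_gt0 d0.
have dn0 : d%:R != 0 :> rat by rewrite pnatr_eq0 -lt0n.
rewrite qE' exprS; move: (_ %| _)%N => /= b.
by field; rewrite g0 dn0.
Qed.

End RootedCount.

(** * From roots to set partitions *)

Section PartitionSums.
Import mathcomp.boot.fintype mathcomp.boot.finset.
Variables (T : finType) (R : comNzRingType) (f : {set T} -> R).

Definition partition_sum (V : {set T}) : R :=
  \sum_(P : {set {set T}} | finset.partition P V) \prod_(B in P) f B.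

Lemma partition_sum0 : partition_sum set0 = 1.
Proof.
rewrite /partition_sum (big_pred1 set0) ?big_set0 // => P.
by rewrite partition_set0.
Qed.

(** Set partitions are sorted by the block [r |: B] that contains a chosen point. *)
Lemma partition_sum_rec (V : {set T}) r : r \in V ->
  partition_sum V
  = \sum_(B : {set T} | B \subset V :\ r) f (r |: B) * partition_sum (V :\: (r |: B)).
Proof.
move=> rV; rewrite /partition_sum.
rewrite (partition_big (fun P => pblock P r :\ r) (fun B : {set T} => B \subset V :\ r)) /=;
  last by move=> P PV; rewrite setSD // (partitionS PV) // pblock_mem // (cover_partition PV).
apply: eq_bigr => B; rewrite subsetD1 => /andP[sBV rB].
have rB0 : r |: B != set0 by apply/set0Pn; exists r; rewrite setU11.
have sV : r |: B \subset V by rewrite subUset sub1set rV.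
rewrite big_distrr /= (reindex_onto (fun P => (r |: B) |: P) (fun P => P :\ (r |: B))) /=.
  have notinP P : finset.partition P (V :\: (r |: B)) -> r |: B \notin P.
    move=> PV; apply/negP => /(partitionS PV)/subsetP/(_ r).
    by rewrite !inE eqxx => /(_ isT).
  have condE P : (finset.partition ((r |: B) |: P) V && (pblock ((r |: B) |: P) r :\ r == B))
      && (((r |: B) |: P) :\ (r |: B) == P) = finset.partition P (V :\: (r |: B)).
    apply/idP/idP => [/andP[/andP[PV _] /eqP <-]|PV].
      by apply: partitionD1; rewrite ?setU11.
    have PV' : finset.partition ((r |: B) |: P) V.
      have -> : V = (r |: B) :|: (V :\: (r |: B)).
        by rewrite -[in LHS](setID V (r |: B)) (setIidPr sV).
      by apply: partitionU1; rewrite // disjoint_sym disjoints_subset setDE subsetIr.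
    rewrite PV' setU1K ?notinP // eqxx andbT.
    rewrite (@def_pblock _ _ (r |: B)) ?setU11 ?(partition_trivIset PV') //.
    by rewrite setU1K ?eqxx.
  apply: eq_big => // P; rewrite condE => PV.
  by rewrite big_setU1 //= notinP.
move=> P /andP[PV /eqP <-]; have rP : r \in cover P by rewrite (cover_partition PV).
have -> : r |: (pblock P r :\ r) = pblock P r by rewrite setD1K ?mem_pblock.
by rewrite setD1K // pblock_mem.
Qed.
End PartitionSums.

Section CliqueCount.
Import mathcomp.boot.fintype mathcomp.boot.finset.
Variables (T : finType) (K : nat) (a : T -> nat) (t : nat).
Hypothesis a_gt0 : forall i, (0 < a i)%N.
Implicit Types (V S B : {set T}).

Definition block_term B : rat :=
  (gcd_of a B %| t * \sum_(i in B) tri (a i))%N%:R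
  * ((gcd_of a B)%:R * (mass a B)%:R ^ (#|B|%:Z - 2)) * t%:R ^+ #|B|.-1.

Lemma clique_rooted_fun r S :
  clique_fun a t S = rooted_fun a t r (t * tri (a r)) (fun=> a r) S.
Proof.
rewrite /rooted_fun /clique_fun.
case: ifPn => rS; last by rewrite addn0 (setDidPl _) // disjoint_sym disjoints1.
by rewrite (mass_split a rS) triD -big_distrl /= -/(mass a _); nia.
Qed.

(** Any vertex [r] of the complete graph can serve as the root, with [u] constant. *)
Lemma card_clique_pts_rec V r : r \in V -> (clique_fun a t V <= K)%N ->
  #|pts K V (clique_fun a t) a|%:R
  = \sum_(B : {set T} | B \subset V :\ r)
      block_term (r |: B) * #|pts K (V :\: (r |: B)) (clique_fun a t) a|%:R.
Proof.
move=> rV leK; set g := rooted_fun a t r (t * tri (a r)) (fun=> a r).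
rewrite (@eq_pts _ _ _ _ g _ (root_mod a r (a r))); first last.
- by move=> i _; rewrite /root_mod; case: eqP => [->|].
- by move=> S _; apply: clique_rooted_fun.
rewrite -[in LHS](setD1K rV) card_rooted_pts //; last 2 first.
- by rewrite !inE eqxx.
- by rewrite setD1K // -clique_rooted_fun.
apply: eq_bigr => B; rewrite subsetD1 => /andP[sBV rB].
rewrite /rooted_summand setDDl; congr (_ * _).
have -> : block_mod a (a r) B = gcd_of a (r |: B).
  by rewrite /block_mod /gcd_of big_setU1.
have -> : (t * tri (a r) + t * \sum_(i in B) tri (a i) = t * \sum_(i in r |: B) tri (a i))%N.
  by rewrite big_setU1 //= mulnDr.
rewrite /block_term -!mulrA; congr (_ * (_ * _)).
have -> : mass a (r |: B) = (mass a B + a r)%N by rewrite /mass big_setU1 //= addnC.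
rewrite cardsU1 rB add1n /=.
have m0 : (mass a B + a r)%:R != 0 :> rat by rewrite pnatr_eq0 -lt0n addn_gt0 a_gt0 orbT.
have r0 : (a r)%:R != 0 :> rat by rewrite pnatr_eq0 -lt0n.
have -> : #|B|.+1%:Z - 2 = #|B|%:Z - 1 by lia.
rewrite expfzDr // -exprnP exprN1.
apply: (mulfI r0); apply: (mulIf m0).
rewrite mulrCA; have := tree_sum_cayley a B (a r).
move: (tree_sum _ _ _) ((_ + _)%:R) m0 => x y y0.
move: (y ^+ _) => z e.
transitivity (t%:R ^+ #|B| * (x * y)); first by field; rewrite r0.
by rewrite e; field.
Qed.

(** Both sides obey the same recursion on the block of a chosen vertex. *)
Theorem card_clique_pts V : (clique_fun a t V <= K)%N ->
  #|pts K V (clique_fun a t) a|%:R = partition_sum block_term V.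
Proof.
have [n] := ubnP #|V|; elim: n => // n IH in V *; rewrite ltnS => le_n leK.
have [->|/set0Pn[r rV]] := eqVneq V set0.
  rewrite partition_sum0; apply/eqP; rewrite pnatr_eq1; apply/cards1P.
  exists [ffun=> ord0]; apply/setP=> z; rewrite in_set1; apply/ptsP/eqP=> [[_ z0 _ _]|->].
    by apply/ffunP => i; apply: val_inj; rewrite /= z0 ?inE // ffunE.
  split=> [i|i _|S|]; rewrite ?inE ?ffunE //.
    by rewrite subset0 => /eqP ->; rewrite /clique_fun /mass !big_set0 muln0.
  by rewrite /clique_fun /mass !big_set0 muln0.
rewrite (@card_clique_pts_rec _ r) // (partition_sum_rec _ rV).
apply: eq_bigr => B sB; congr (_ * _); apply: IH.
  apply: leq_trans le_n; rewrite [X in (_ < X)%N](cardsD1 r) rV add1n ltnS.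
  by rewrite subset_leq_card // -setDDl subsetDl.
apply: leq_trans leK; rewrite leq_mul // leq_tri // /mass.
by rewrite [X in (_ <= X)%N](big_setID (r |: B)) leq_addl.
Qed.
End CliqueCount.

(** * Divisibility and compatible partitions *)

Section Compatibility.
Import mathcomp.boot.fintype mathcomp.boot.finset.
Variables (T : finType) (a : T -> nat).
Hypothesis a_gt0 : forall i, (0 < a i)%N.
Implicit Types (B : {set T}).
Local Open Scope nat_scope.

Lemma gcd_of_dvd B i : i \in B -> gcd_of a B %| a i.
Proof. by move=> iB; rewrite /gcd_of (big_setD1 i) //= dvdn_gcdl. Qed.

Lemma dvd_gcd_of B e : (forall i, i \in B -> e %| a i) -> e %| gcd_of a B.
Proof.
by move=> H; rewrite /gcd_of; elim/big_ind: _ => // x y ex ey; rewrite dvdn_gcd ex.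
Qed.

Lemma sum_tri2 B : (\sum_(i in B) tri (a i)).*2 = \sum_(i in B) a i * (a i).+1.
Proof. by rewrite -muln2 big_distrl; apply: eq_bigr => i _; rewrite /= muln2 tri2. Qed.

Lemma gcd_of_dvd_sum_tri2 B t : gcd_of a B %| t * (\sum_(i in B) tri (a i)).*2.
Proof.
rewrite sum_tri2 dvdn_mull // dvdn_sum // => i iB.
by rewrite dvdn_mulr // gcd_of_dvd.
Qed.

Lemma gcd_of_dvd_even B t : ~~ odd t -> gcd_of a B %| t * \sum_(i in B) tri (a i).
Proof.
by move=> /even_halfK <-; rewrite -doubleMl doubleMr gcd_of_dvd_sum_tri2.
Qed.

Lemma odd_sum (B : {set T}) (F : T -> nat) :
  odd (\sum_(i in B) F i) = odd #|[set i in B | odd (F i)]|.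
Proof.
rewrite -sum1_card (big_morph odd oddD (erefl _)) [RHS](big_morph odd oddD (erefl _)).
rewrite (bigID (fun i => odd (F i))) /= [X in _ (+) X]big1 ?addbF.
  by apply: eq_big => [i|i /andP[_ ->]]; rewrite // inE.
by move=> i /andP[_ /negbTE].
Qed.

(** The gcd divides twice the sum of the [tri (a i)], so only its power of 2 matters.
    If all lengths in [B] are even, write [a i = b i * 2 ^ e] with [e] their least
    valuation: twice the sum is [2 ^ e] times the sum of the [b i * (a i).+1], which is
    even exactly when an even number of [b i] are odd, that is when an even number of
    indices attain [e]. *)
Lemma gcd_of_dvd_odd B t : odd t -> B != set0 ->
  (gcd_of a B %| t * \sum_(i in B) tri (a i)) =
  [exists j in B, odd (a j)]
    || ~~ odd #|[set j in B | [forall k in B, logn 2 (a j) <= logn 2 (a k)]]|.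
Proof.
move=> ot /set0Pn[i0 i0B]; set X := \sum_(i in B) _; set d := gcd_of a B.
have dX : d %| t * X * 2 by rewrite -mulnA muln2 gcd_of_dvd_sum_tri2.
case: (boolP [exists j in B, odd (a j)]) => [/existsP[j /andP[jB oj]]|].
  have od : odd d by apply: dvdn_odd (gcd_of_dvd jB) oj.
  by rewrite /= -(Gauss_dvdl _ (_ : coprime d 2)) // coprimen2.
rewrite negb_exists => /forallP all_even /=.
case: (arg_minnP (fun i => logn 2 (a i)) i0B) => j; rewrite -/(j \in B) => jB jmin.
set e := logn 2 (a j) in jmin.
pose b i := a i %/ 2 ^ e.
have aE i : i \in B -> a i = b i * 2 ^ e.
  by move=> iB; rewrite divnK // pfactor_dvdn ?jmin.
have ob i : i \in B -> odd (b i) = (logn 2 (a i) == e).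
  move=> iB; have b0 : 0 < b i by move: (a_gt0 i); rewrite (aE i iB); case: (b i).
  rewrite (aE i iB) lognM ?expn_gt0 // pfactorK // -[X in _ == X]add0n eqn_add2r.
  by rewrite eqn0Ngt logn_gt0 mem_primes b0 dvdn2 negbK.
have -> : [set j in B | [forall k in B, logn 2 (a j) <= logn 2 (a k)]]
    = [set i in B | odd (b i)].
  apply/setP=> i; rewrite !inE; case: (boolP (i \in B)) => //= iB; rewrite ob //.
  apply/idP/eqP => [/forallP/(_ j)|->]; last by apply/forallP=> k; apply/implyP/jmin.
  by rewrite jB /= => le; apply/eqP; rewrite eqn_leq le jmin.
have -> : odd #|[set i in B | odd (b i)]| = odd (\sum_(i in B) b i * (a i).+1).
  rewrite odd_sum; congr (odd #|pred_of_set _|); apply/setP=> i; rewrite !inE.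
  case: (boolP (i \in B)) => //= iB; rewrite oddM /=.
  by have := all_even i; rewrite iB /= => ->; rewrite andbT.
have ed : 2 ^ e %| d by apply: dvd_gcd_of => i /aE ->; rewrite dvdn_mull.
have om : odd (d %/ 2 ^ e).
  have bj : odd (b j) by rewrite ob.
  apply: dvdn_odd bj; rewrite -(dvdn_pmul2r (expn_gt0 2 e : 0 < 2 ^ e)) divnK // -aE //.
  exact: gcd_of_dvd.
have cop : coprime (d %/ 2 ^ e) (2 ^ e) by rewrite coprimeXr // coprimen2.
rewrite -(divnK ed) Gauss_dvd // [X in X && _](_ : _ = true) /=; last first.
  rewrite -(Gauss_dvdl _ (_ : coprime _ 2)) ?coprimen2 //.
  by apply: dvdn_trans dX; rewrite -{2}(divnK ed) dvdn_mulr.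
rewrite Gauss_dvdr; last by rewrite coprimeXl // coprime2n.
have -> : (2 ^ e %| X) = (2 * 2 ^ e %| (\sum_(i in B) b i * (a i).+1) * 2 ^ e).
  rewrite [2 * _]mulnC -(dvdn_pmul2r (isT : 0 < 2)) [X * 2]muln2 sum_tri2.
  congr (_ %| _); rewrite big_distrl; apply: eq_bigr => i /aE {1}->.
  by rewrite /= mulnAC.
by rewrite dvdn_pmul2r ?expn_gt0 // dvdn2.
Qed.

End Compatibility.

Section CompatiblePartitions.
Import mathcomp.boot.fintype mathcomp.boot.finset.
Variables (l : seq nat) (t : nat).
Hypothesis l_gt0 : forall j : 'I_(size l), (0 < part j)%N.
Implicit Type P : {set {set 'I_(size l)}}.

Lemma sum_pred_card P : finset.partition P [set: 'I_(size l)] ->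
  (\sum_(B in P) #|B|.-1 = size l - #|P|)%N.
Proof.
move=> PT; have := card_partition PT; rewrite cardsT card_ord.
rewrite (eq_bigr (fun B : {set 'I_(size l)} => #|B|.-1 + 1)%N) => [|B BP]; last first.
  by rewrite addn1 prednK // card_gt0 (partition_neq0 PT).
by rewrite big_split sum1_card /= => lE; rewrite [X in _ = (X - _)%N]lE addnK.
Qed.

Lemma block_indicator B : B != set0 ->
  (gcd_of (@part l) B %| t * \sum_(i in B) tri (part i))%N =
  ~~ odd t || ([exists j in B, odd (part j)] || ~~ odd #|min_val2_indices B|).
Proof.
case: (boolP (odd t)) => [ot|et] B0; last exact: gcd_of_dvd_even.
exact: gcd_of_dvd_odd.
Qed.

Lemma prod_block_term P : finset.partition P [set: 'I_(size l)] ->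
  \prod_(B in P) block_term (@part l) t B
  = (~~ odd t || compatible P)%:R * (vcoef P * t%:R ^+ (size l - #|P|)).
Proof.
move=> PT; rewrite /block_term big_split /= -expr_sum sum_pred_card // big_split /= -mulrA.
congr (_ * (_ * _)).
have -> : ~~ odd t || compatible P =
    [forall B in P, (gcd_of (@part l) B %| t * \sum_(i in B) tri (part i))%N].
  apply/idP/forallP => [H B|H].
    apply/implyP=> BP; rewrite block_indicator ?(partition_neq0 PT) //.
    by case/orP: H => [->//|/forallP/(_ B)]; rewrite BP => /= ->; rewrite orbT.
  case: (boolP (odd t)) => //= ot; apply/forallP=> B; apply/implyP=> BP.
  by have := H B; rewrite BP /= block_indicator ?(partition_neq0 PT) // ot.
rewrite -big_andE (big_morph (fun b : bool => b%:R) (id1 := 1) (op1 := *%R)) //.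
by case=> -[]; rewrite ?mulr1 ?mulr0.
Qed.

Lemma partition_sum_block_term :
  partition_sum (block_term (@part l) t) [set: 'I_(size l)]
  = (if ~~ odd t then
      \sum_(P : {set {set 'I_(size l)}} | finset.partition P [set: 'I_(size l)])
        vcoef P * t%:R ^+ (size l - #|P|)
    else
      \sum_(P : {set {set 'I_(size l)}} |
          finset.partition P [set: 'I_(size l)] && compatible P)
        vcoef P * t%:R ^+ (size l - #|P|)) :> rat.
Proof.
rewrite /partition_sum (eq_bigr _ (fun P => @prod_block_term P)).
case: ifP => [_|ot]; first by apply: eq_bigr => P _; rewrite mul1r.
by rewrite [RHS]big_mkcondr; apply: eq_bigr => P _ /=; case: compatible; rewrite ?mul1r ?mul0r.
Qed.

End CompatiblePartitions.

(** * Majorization *)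

Section Majorization.
Variables (R : realType) (n : nat).
Implicit Types (x y : 'rV[R]_n) (C : set 'rV[R]_n).
Local Open Scope classical_set_scope.

Lemma convex_set_comb C x y (c : R) : @convex_set R 'rV[R]_n C ->
  0 <= c <= 1 -> C x -> C y -> C (c *: x + (1 - c) *: y).
Proof.
move=> convC /andP[c0 c1] Cx Cy.
by have := convC x y (Itv01 c0 c1); rewrite !inE; apply.
Qed.

(** A Robin Hood transfer of [e] from coordinate [k] to coordinate [j] is a convex
    combination of a point and its image by the transposition of [j] and [k]. *)
Definition transfer y (j k : 'I_n) (e : R) : 'rV[R]_n :=
  \row_i (y 0 i + (if i == j then e else 0) - (if i == k then e else 0)).

Lemma transfer_in_convex C y j k e : @convex_set R 'rV[R]_n C ->
  (forall (s : 'S_n) x, C x -> C (perm_act s x)) -> j != k ->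
  0 <= e -> e <= y 0 k - y 0 j -> C y -> C (transfer y j k e).
Proof.
move=> convC permC jk e0 ley Cy.
have [e00|en0] := eqVneq e 0.
  rewrite (_ : transfer _ _ _ _ = y) //; apply/rowP=> i.
  by rewrite mxE e00 !if_same addr0 subr0.
have ygt0 : 0 < y 0 k - y 0 j by apply: lt_le_trans ley; rewrite lt_def en0.
pose c := e / (y 0 k - y 0 j).
have -> : transfer y j k e = c *: perm_act (tperm j k) y + (1 - c) *: y.
  apply/rowP=> i; rewrite !mxE.
  have ce : c * (y 0 k - y 0 j) = e by rewrite /c divfK // gt_eqF.
  rewrite -{1 2}ce; have [->|ij] := eqVneq i j.
    by rewrite tpermL (negPf jk); lra.
  have [->|ik] := eqVneq i k; first by rewrite tpermR; lra.
  by rewrite tpermD 1?eq_sym //; lra.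
apply: convex_set_comb => //; last exact: permC.
by rewrite divr_ge0 ?(ltW ygt0) //= ler_pdivrMr // mul1r.
Qed.

Lemma sum_transfer y j k e (P : pred 'I_n) :
  \sum_(i | P i) transfer y j k e 0 i
  = \sum_(i | P i) y 0 i + (if P j then e else 0) - (if P k then e else 0).
Proof.
under eq_bigr do rewrite mxE.
rewrite sumrB big_split /=; congr (_ + _ - _).
  rewrite -big_mkcondr; case: ifPn => Pj; last first.
    by rewrite big1 // => i /andP[Pi /eqP ij]; rewrite -ij Pi in Pj.
  by rewrite (big_pred1 j) // => i /=; case: eqP => [->|]; rewrite ?Pj ?andbF.
rewrite -big_mkcondr; case: ifPn => Pk; last first.
  by rewrite big1 // => i /andP[Pi /eqP ik]; rewrite -ik Pi in Pk.
by rewrite (big_pred1 k) // => i /=; case: eqP => [->|]; rewrite ?Pk ?andbF.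
Qed.

(** Rado's theorem. Let [j] be the first coordinate where [x] and [y] differ and [k] the
    first one where [y] exceeds [x]. Transferring from [k] to [j] until one of
    these two coordinates agrees with [x] keeps the prefix sums of [y] below those of
    [x]. *)
Theorem majorization_convex C x y : @convex_set R 'rV[R]_n C ->
  (forall (s : 'S_n) x, C x -> C (perm_act s x)) -> C y ->
  (forall i j : 'I_n, (i <= j)%N -> x 0 i <= x 0 j) ->
  (forall p : nat, \sum_(i < n | (i < p)%N) y 0 i <= \sum_(i < n | (i < p)%N) x 0 i) ->
  \sum_i y 0 i = \sum_i x 0 i -> C x.
Proof.
move=> convC permC + xincr.
have [N] := ubnP #|[pred i | x 0 i != y 0 i]|; elim: N => // N IH in y *.
rewrite ltnS => leN Cy lexy sumxy.
have [i0 neq0|eqxy] := pickP [pred i | x 0 i != y 0 i]; last first.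
  by rewrite (_ : x = y) //; apply/rowP=> i; apply/eqP; have := eqxy i; move/negbFE.
case: (@arg_minnP _ i0 [pred i | x 0 i != y 0 i] val neq0) => j /= xyj jmin.
have ltj : y 0 j < x 0 j.
  rewrite lt_def xyj; have := lexy j.+1; rewrite (bigD1 j) //= [X in _ <= X](bigD1 j) //=.
  rewrite [X in _ + X <= _](eq_bigr (fun i => x 0 i)) ?lerD2r // => i.
  rewrite ltnS => /andP[le_ij neq_ij]; apply/eqP; rewrite eq_sym; apply: contraNT neq_ij => xyi.
  by apply/eqP/val_inj/eqP; rewrite eqn_leq le_ij jmin.
have [k0 ltk0|ge] := pickP [pred i | x 0 i < y 0 i]; last first.
  have ge' i : y 0 i <= x 0 i by rewrite leNgt; have := ge i => /= ->.
  have : \sum_i y 0 i < \sum_i x 0 i.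
    rewrite (bigD1 j) //= [X in _ < X](bigD1 j) //=; apply: ltr_leD => //.
    exact: ler_sum.
  by rewrite sumxy ltxx.
case: (@arg_minnP _ k0 [pred i | x 0 i < y 0 i] val ltk0) => k /= ltk kmin {i0 neq0 k0 ltk0}.
have lejk : (j <= k)%N by apply: jmin; rewrite lt_eqF.
have jk : j != k by apply: contraTneq ltk => <-; rewrite -leNgt ltW.
have xjk : x 0 j <= x 0 k by apply: xincr.
pose e := Num.min (x 0 j - y 0 j) (y 0 k - x 0 k).
have e_j : e <= x 0 j - y 0 j by rewrite ge_min lexx.
have e_k : e <= y 0 k - x 0 k by rewrite ge_min lexx orbT.
have e0 : 0 < e by rewrite lt_min !subr_gt0 ltj.
apply: (IH (transfer y j k e)).
- apply: leq_trans leN; apply: proper_card; apply/properP; split.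
    apply/fintype.subsetP=> i; rewrite !inE mxE; apply: contraNN => /eqP xyi.
    have /negPf-> : i != j by apply: contraNneq xyj => <-; rewrite xyi.
    have /negPf-> : i != k by apply: contraTneq ltk => <-; rewrite xyi ltxx.
    by rewrite addr0 subr0 xyi.
  have [le|lt] := leP (x 0 j - y 0 j) (y 0 k - x 0 k).
    exists j; rewrite !inE // negbK mxE eqxx (negPf jk) /e; apply/eqP.
    by rewrite (min_idPl le); lra.
  exists k; first by rewrite inE lt_eqF.
  rewrite !inE negbK mxE eqxx eq_sym [k == j]eq_sym (negPf jk) /e; apply/eqP.
  by rewrite (min_idPr (ltW lt)); lra.
- by apply: transfer_in_convex => //; [exact: ltW|lra].
- move=> p; rewrite sum_transfer; have := lexy p.
  case: (ltnP k p) => kp; first by rewrite (leq_ltn_trans lejk kp); lra.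
  case: (ltnP j p) => jp; last by lra.
  move=> _; rewrite subr0 (bigD1 j) //= [X in _ <= X](bigD1 j) //=.
  suff : \sum_(i < n | (i < p)%N && (i != j)) y 0 i <= \sum_(i < n | (i < p)%N && (i != j)) x 0 i.
    by lra.
  apply: ler_sum => i /andP[ip _]; rewrite leNgt; apply/negP => /kmin.
  by rewrite leqNgt (leq_trans ip).
- by rewrite sum_transfer /= sumxy addrK.
Qed.

Lemma exists_sorting_perm x :
  exists s : 'S_n, forall i j : 'I_n, (i <= j)%N -> x 0 (s i) <= x 0 (s j).
Proof.
pose tx := [tuple x 0 i | i < n]; pose ty := sort_tuple <=%R tx.
have /tuple_permP[s tyE] : perm_eq ty tx by rewrite perm_sort.
exists s => i j ij.
have nthE (k : 'I_n) : nth 0 ty k = x 0 (s k).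
  by rewrite tyE (nth_map k) -?enumT ?size_enum_ord // nth_ord_enum tnth_mktuple.
rewrite -!nthE; apply: (sorted_leq_nth (leT := <=%R)) => //.
- exact: le_trans.
- exact: sort_le_sorted.
- by rewrite inE size_tuple.
- by rewrite inE size_tuple.
Qed.

(** Between two level sets the prefix sums of a sorted vector are affine in the size of
    the prefix, whereas [tri] is convex. *)
Lemma tri_interpolation (a p b : nat) (XA v : R) :
  (a <= p)%N -> (p < b)%N ->
  (tri a)%:R <= XA -> (tri b)%:R <= XA + (b - a)%:R * v ->
  (tri p)%:R <= XA + (p - a)%:R * v.
Proof.
move=> ap pb.
have triE k : (tri k)%:R = k%:R * (k%:R + 1) / 2 :> R.
  by rewrite natr1 -natrM -tri2 -muln2 natrM mulfK // pnatr_eq0.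
rewrite !triE !natrB ?(ltnW pb) ?(leq_trans ap (ltnW pb)) //.
have : a%:R <= p%:R :> R by rewrite ler_nat.
have : p%:R < b%:R :> R by rewrite ltr_nat.
move: (a%:R) (p%:R) (b%:R) => {ap pb triE} {}a {}p {}b pb ap hA hB.
have ba : 0 < b - a by lra.
have bp0 : 0 <= b - p by lra.
have pa0 : 0 <= p - a by lra.
have h1 := ler_wpM2l bp0 hA; have h2 := ler_wpM2l pa0 hB.
have h3 : 0 <= (b - a) * (b - p) * (p - a) by rewrite !mulr_ge0 // ltW.
by rewrite -(ler_pM2l ba); lra.
Qed.
End Majorization.

(** * The permutahedron *)

Section Permutahedron.
Variables (R : realType) (n : nat).
Implicit Types (x y : 'rV[R]_n) (S : {set 'I_n}).
Local Open Scope classical_set_scope.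

Lemma tri_leq_sum S : (tri #|S| <= \sum_(i in S) i.+1)%N.
Proof.
have [N] := ubnP #|S|; elim: N => // N IH in S *; rewrite ltnS => leN.
have [->|/finset.set0Pn[i0 i0S]] := eqVneq S finset.set0.
  by rewrite cards0 big_set0.
case: (arg_maxnP val i0S) => i; rewrite -/(i \in S) => iS imax.
have leS : (#|S| <= i.+1)%N.
  have <- : #|[pred j : 'I_n | (j < i.+1)%N]| = i.+1.
    rewrite -sum1_card -(big_mkord (fun j => (j < i.+1)%N) (fun=> 1%N)).
    by rewrite -(big_nat_widen 0 i.+1 n xpredT) // sum_nat_const_nat muln1 subn0.
  by apply/subset_leq_card/fintype.subsetP=> j /imax; rewrite !inE ltnS.
have cardE : #|S| = #|(S :\ i)%SET|.+1 by rewrite (cardsD1 i) iS.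
rewrite cardE in leN leS *; rewrite (big_setD1 i) //= -addn1 triD muln1.
have := IH _ leN; rewrite -[tri 1]/1%N -addnA add1n addnC => IHS.
exact: leq_add.
Qed.

Lemma sum_prefix p : (p <= n)%N -> (\sum_(i < n | (i < p)%N) i.+1 = tri p)%N.
Proof.
move=> pn; rewrite -(big_mkord (fun i => (i < p)%N) (fun i => i.+1)).
rewrite -(big_nat_widen 0 p n xpredT) //.
elim: p {pn} => [|p IH]; first by rewrite big_geq.
by rewrite big_nat_recr //= IH -[in RHS]addn1 triD muln1 -[tri 1]/1%N; lia.
Qed.

Lemma permutahedron_convex : @convex_set R 'rV[R]_n (permutahedron R n).
Proof.
move=> x y c /set_mem Hx /set_mem Hy; apply/mem_set => A [convA subA].
by apply/set_mem/convA; apply/mem_set; [apply: Hx|apply: Hy].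
Qed.

Lemma permutahedron_std : permutahedron R n (std_point R n).
Proof. by move=> A [_]; apply; exists 1%g => //; apply/rowP=> i; rewrite !mxE perm1. Qed.

Lemma permutahedron_perm (s : 'S_n) x :
  permutahedron R n x -> permutahedron R n (perm_act s x).
Proof.
move: x; apply: smallest_sub => [x y c /set_mem Hx /set_mem Hy|_ [s' _ <-]].
  apply/mem_set => /=.
  have -> : perm_act s (conv c x y) = c%:num *: perm_act s x + (1 - c%:num) *: perm_act s y.
    by apply/rowP=> i; rewrite !mxE.
  apply: convex_set_comb permutahedron_convex _ Hx Hy.
  by rewrite ge0 le1.
move=> A [_] /=; apply; exists (s * s')%g => //.
by apply/rowP=> i; rewrite !mxE permM.
Qed.

Lemma permutahedron_tri_le x S : permutahedron R n x ->
  (tri #|S|)%:R <= \sum_(i in S) x 0 i.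
Proof.
move: x; apply: smallest_sub => [x y c /set_mem /= Hx /set_mem /= Hy|_ [s _ <-] /=].
  apply/mem_set => /=.
  under eq_bigr do rewrite !mxE.
  rewrite big_split /= -!big_distrr /= /unstable.onem.
  have c0 : 0 <= c%:num by rewrite ge0.
  have c1 : 0 <= 1 - c%:num by rewrite subr_ge0 le1.
  have := ler_wpM2l c0 Hx; have := ler_wpM2l c1 Hy.
  move: (c%:num) c0 c1 => r r0 r1.
  move: (\sum_(i in S) x 0 i) (\sum_(i in S) y 0 i) ((tri _)%:R : R) => X Y Z.
  by lra.
under eq_bigr do rewrite !mxE.
rewrite -natr_sum ler_nat -(card_imset _ (@perm_inj _ s)).
apply: leq_trans (tri_leq_sum _) _.
by rewrite big_imset //=; apply: in2W; apply: perm_inj.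
Qed.

Lemma permutahedron_sum x : permutahedron R n x -> \sum_i x 0 i = (tri n)%:R.
Proof.
move: x; apply: smallest_sub => [x y c /set_mem /= Hx /set_mem /= Hy|_ [s _ <-] /=].
  apply/mem_set => /=.
  under eq_bigr do rewrite !mxE.
  by rewrite big_split /= -!big_distrr /= Hx Hy /unstable.onem; ring.
under eq_bigr do rewrite !mxE.
rewrite -natr_sum; congr _%:R; rewrite -(sum_prefix (leqnn n)).
rewrite [RHS](reindex_inj (@perm_inj _ s)) /=.
by apply: eq_bigl => i; rewrite ltn_ord.
Qed.

(** Only the level sets of [x] need to be tested, and those of a point fixed by a
    permutation are unions of its cycles. *)
Theorem level_sets_permutahedron x :
  (forall v, (tri #|[pred i | (x 0 i < v)%R]|)%:R <= \sum_(i | (x 0 i < v)%R) x 0 i) ->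
  (forall v, (tri #|[pred i | (x 0 i <= v)%R]|)%:R <= \sum_(i | (x 0 i <= v)%R) x 0 i) ->
  \sum_i x 0 i = (tri n)%:R -> permutahedron R n x.
Proof.
move=> lt_x le_x sum_x; have [s s_incr] := exists_sorting_perm x.
have -> : x = perm_act s^-1 (perm_act s x).
  by apply/rowP=> i; rewrite !mxE permKV.
apply: permutahedron_perm; set x' := perm_act s x.
have x'E i : x' 0 i = x 0 (s i) by rewrite mxE.
have sumE (P : pred R) : \sum_(i | P (x 0 i)) x 0 i = \sum_(i | P (x' 0 i)) x' 0 i.
  by rewrite (reindex_inj (@perm_inj _ s)); apply: eq_big => [i|i _]; rewrite x'E.
have cardE (P : pred R) : #|[pred i | P (x 0 i)]| = #|[pred i | P (x' 0 i)]|.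
  rewrite -!sum1_card (reindex_inj (@perm_inj _ s)).
  by apply: eq_bigl => i; rewrite !inE x'E.
apply: (majorization_convex permutahedron_convex permutahedron_perm permutahedron_std).
- by move=> i j ij; rewrite !x'E s_incr.
- move=> p; have stdE q : (q <= n)%N ->
      \sum_(i < n | (i < q)%N) std_point R n 0 i = (tri q)%:R.
    by move=> qn; rewrite -(sum_prefix qn) natr_sum; apply: eq_bigr => i _; rewrite mxE.
  have [np|pn] := leqP n p.
    rewrite (eq_bigl xpredT) => [|i]; last by rewrite (leq_trans (ltn_ord i)).
    rewrite [X in _ <= X](eq_bigl xpredT) => [|i]; last by rewrite (leq_trans (ltn_ord i)).
    rewrite -(sumE xpredT) sum_x -(stdE n (leqnn n)) le_eqVlt; apply/orP; left; apply/eqP.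
    by apply: eq_bigl => i; rewrite ltn_ord.
  rewrite stdE ?(ltnW pn) //; pose v := x' 0 (Ordinal pn).
  (* the level sets below and at the value of the first entry outside the prefix *)
  pose A := [pred i | x' 0 i < v]; pose B := [pred i | x' 0 i <= v].
  have A_p i : i \in A -> (i < p)%N.
    by rewrite inE ltNge; apply: contraR; rewrite -leqNgt => pi; rewrite /v !x'E s_incr.
  have p_B (i : 'I_n) : (i <= p)%N -> i \in B by move=> ip; rewrite inE /v !x'E s_incr.
  have hA := lt_x v; have hB := le_x v.
  rewrite (sumE (fun z => z < v)) (cardE (fun z => z < v)) in hA.
  rewrite (sumE (fun z => z <= v)) (cardE (fun z => z <= v)) in hB.
  have card_p q : (q <= n)%N -> #|[pred i : 'I_n | (i < q)%N]| = q.
    move=> qn; rewrite -sum1_card -(big_mkord (fun j => (j < q)%N) (fun=> 1%N)).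
    by rewrite -(big_nat_widen 0 q n xpredT) // sum_nat_const_nat muln1 subn0.
  have Ap : (#|A| <= p)%N.
    by rewrite -[X in (_ <= X)%N](card_p p (ltnW pn)); apply/subset_leq_card/fintype.subsetP.
  have pB : (p < #|B|)%N.
    rewrite -[X in (X <= _)%N](card_p _ pn); apply/subset_leq_card/fintype.subsetP => i.
    by rewrite inE ltnS => /p_B.
  have interp (Q : pred 'I_n) : {subset A <= Q} -> {subset Q <= B} ->
      \sum_(i | Q i) x' 0 i = \sum_(i in A) x' 0 i + (#|Q| - #|A|)%:R * v.
    move=> AQ QB; rewrite (bigID (mem A)) /=; congr (_ + _).
      by apply: eq_bigl => i; apply: andb_idl => /AQ.
    rewrite (eq_bigr (fun=> v)) => [|i /andP[/QB Qi Ai]]; last first.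
      by apply/eqP; move: Qi Ai; rewrite !inE -leNgt eq_le => -> ->.
    rewrite (eq_bigl (mem [predD Q & A])) => [|i]; last by rewrite !inE andbC.
    rewrite sumr_const mulr_natl; congr (_ *+ _).
    rewrite -[X in (X - _)%N](cardID A Q) (eq_card (_ : [predI Q & A] =i A)) ?addKn // => i.
    by rewrite inE; apply: andb_idl => /AQ.
  rewrite (interp _) ?card_p ?(ltnW pn) //; last by move=> i /ltnW/p_B.
  apply: (@tri_interpolation _ #|A| p #|B|) => //.
  by rewrite -(interp (mem B)) // => i /A_p/ltnW/p_B.
- rewrite -(sumE xpredT) sum_x; under eq_bigr do rewrite mxE.
  rewrite -natr_sum -(sum_prefix (leqnn n)); congr _%:R.
  by apply: eq_bigl => i; rewrite ltn_ord.
Qed.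

End Permutahedron.

Lemma card_fset_set_injective (S : finType) (T : choiceType) (X : {set S}) (f : S -> T)
    (A : set T) : {in X &, injective f} ->
  (forall y, A y <-> exists2 x, x \in X & y = f x) ->
  finite_set A /\ #|` fset_set A| = #|X|.
Proof.
move=> f_inj AE; pose F := seq_fset tt [seq f x | x <- enum X].
have -> : A = [set` F]%classic.
  apply/seteqP; split=> y /=; rewrite seq_fsetE.
    by move/AE=> [x xX ->]; apply: map_f; rewrite mem_enum.
  by case/mapP=> x; rewrite mem_enum => xX ->; apply/AE; exists x.
split; first exact: finite_fset.
rewrite set_fsetK size_seq_fset undup_id ?size_map -?cardE //.
by rewrite map_inj_in_uniq ?enum_uniq // => x y; rewrite !mem_enum; apply: f_inj.
Qed.

(** * Lattice points fixed by a permutation *)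

Section FixedPoints.
Variables (R : realType) (n m : nat) (s : 'S_n) (t : nat).
Variables (cyc : 'I_n -> 'I_m) (len : 'I_m -> nat).
Hypothesis t_gt0 : (0 < t)%N.
Hypothesis lenE : forall j, len j = #|[pred i | cyc i == j]|.
Hypothesis len_gt0 : forall j, (0 < len j)%N.
Hypothesis cycE : forall x : 'rV[R]_n,
  perm_act s x = x <-> (forall i i', cyc i = cyc i' -> x 0 i = x 0 i').
Local Open Scope classical_set_scope.

Let K := (t * tri n)%N.

Lemma sum_cyc (V : nmodType) (P : pred 'I_m) (F : 'I_m -> V) :
  \sum_(i | P (cyc i)) F (cyc i) = \sum_(j | P j) F j *+ len j.
Proof.
rewrite (partition_big cyc P) //=; apply: eq_bigr => j Pj.
rewrite (eq_bigr (fun=> F j)) => [|i /andP[_ /eqP->//]].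
rewrite lenE -sumr_const; apply: eq_bigl => i.
by rewrite !inE; case: eqP => [->|]; rewrite ?Pj ?andbF.
Qed.

Lemma card_cyc (P : pred 'I_m) : #|[pred i | P (cyc i)]| = (\sum_(j | P j) len j)%N.
Proof.
rewrite -sum1_card (sum_cyc P (fun=> 1%N)).
by apply: eq_bigr => j _; apply: natn.
Qed.

Lemma mass_len : mass len finset.setT = n.
Proof.
rewrite /mass (eq_bigl xpredT) => [|j]; last by rewrite inE.
by rewrite -(card_cyc xpredT) -[RHS]card_ord; apply: eq_card.
Qed.

Lemma clique_fun_len_setT : clique_fun len t finset.setT = K.
Proof. by rewrite /clique_fun mass_len. Qed.

(** [z j] stands for the sum over the cycle [j] of a vector constant on that cycle. *)
Definition spread (z : {ffun 'I_m -> 'I_K.+1}) : 'rV[R]_n :=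
  \row_i (z (cyc i) %/ len (cyc i))%:R.

Lemma spreadE z i : spread z 0 i = (z (cyc i) %/ len (cyc i))%:R.
Proof. by rewrite mxE. Qed.

Let cycle_points := pts K finset.setT (clique_fun len t) len.
Let t0 : t%:R != 0 :> R. Proof. by rewrite pnatr_eq0 -lt0n. Qed.

Lemma sum_spread (z : {ffun 'I_m -> 'I_K.+1}) (P : pred 'I_m) : z \in cycle_points ->
  \sum_(i | P (cyc i)) spread z 0 i = (\sum_(j | P j) z j)%:R.
Proof.
move=> /ptsP[dz _ _ _]; under [LHS]eq_bigr do rewrite spreadE.
rewrite (sum_cyc P (fun j => (z j %/ len j)%:R)) natr_sum.
by apply: eq_bigr => j _; rewrite -mulrnA divnK ?dz ?inE.
Qed.

Lemma spread_lattice_point z : z \in cycle_points ->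
  lattice_points t (fixed_permutahedron R s) (spread z).
Proof.
move=> zP; case/ptsP: (zP) => dz _ gz zT; split; last by move=> i; rewrite spreadE.
exists (t%:R^-1 *: spread z); last by rewrite scalerA mulfV ?scale1r.
have level (P : pred 'I_m) : (tri #|[pred i | P (cyc i)]|)%:R
    <= \sum_(i | P (cyc i)) (t%:R^-1 *: spread z) 0 i.
  under eq_bigr do rewrite mxE.
  rewrite -big_distrr /= sum_spread // card_cyc ler_pdivlMl ?ltr0n // -natrM ler_nat.
  have := gz [set j | P j]%SET (finset.subsetT _).
  rewrite /clique_fun /mass.
  rewrite (eq_bigl P) => [|j]; last by rewrite inE.
  by rewrite [X in (_ <= X)%N -> _](eq_bigl P) => [//|j]; rewrite inE.
pose f j : R := t%:R^-1 * (z j %/ len j)%:R.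
have fE i : (t%:R^-1 *: spread z) 0 i = f (cyc i) by rewrite mxE spreadE.
split; last by apply/cycE => i i' e; rewrite !fE e.
apply: level_sets_permutahedron => [v|v|].
- rewrite (eq_card (_ : _ =i [pred i | f (cyc i) < v])) => [|i]; last by rewrite !inE fE.
  rewrite (eq_bigl (fun i => f (cyc i) < v)) => [|i]; last by rewrite fE.
  exact: level (fun j => f j < v).
- rewrite (eq_card (_ : _ =i [pred i | f (cyc i) <= v])) => [|i]; last by rewrite !inE fE.
  rewrite (eq_bigl (fun i => f (cyc i) <= v)) => [|i]; last by rewrite fE.
  exact: level (fun j => f j <= v).
- under eq_bigr do rewrite mxE.
  rewrite -big_distrr /= (sum_spread xpredT) //.
  rewrite (eq_bigl (mem finset.setT)) => [|j]; last by rewrite !inE.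
  by rewrite zT clique_fun_len_setT natrM mulKf.
Qed.

Lemma lattice_point_spread x : lattice_points t (fixed_permutahedron R s) x ->
  exists2 z, z \in cycle_points & x = spread z.
Proof.
move=> [[p [pP /cycE pfix] xE] xint].
have x_p i : x 0 i = t%:R * p 0 i by rewrite -xE mxE.
have x_nat i : exists k : nat, x 0 i == k%:R.
  have p1 : 1 <= p 0 i.
    have := permutahedron_tri_le [set i]%SET pP.
    by rewrite cards1 big_set1 -[tri 1]/1%N.
  have : x 0 i \is a Num.nat.
    by rewrite natrEint xint x_p mulr_ge0 ?ler0n ?(le_trans ler01).
  by move/natrP => [k ->]; exists k.
have cyc_surj j : exists i, cyc i == j.
  by have := len_gt0 j; rewrite lenE => /card_gt0P[i]; rewrite inE; exists i.
pose y j := xchoose (x_nat (xchoose (cyc_surj j))).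
have xy i : x 0 i = (y (cyc i))%:R.
  rewrite -(eqP (xchooseP (x_nat (xchoose (cyc_surj (cyc i)))))) !x_p.
  by congr (_ * _); apply: pfix; rewrite (eqP (xchooseP (cyc_surj (cyc i)))).
have sum_y (P : pred 'I_m) : (\sum_(j | P j) y j * len j)%N%:R = t%:R * \sum_(i | P (cyc i)) p 0 i.
  rewrite big_distrr /=; under [RHS]eq_bigr do rewrite -x_p xy.
  rewrite (sum_cyc P (fun j => (y j)%:R)) natr_sum.
  by apply: eq_bigr => j _; rewrite natrM mulr_natr.
have total : (\sum_j y j * len j = K)%N.
  apply: (@mulrIn R 1); first by rewrite oner_eq0.
  by rewrite (sum_y xpredT) (permutahedron_sum pP) natrM.
have y_le j : (y j * len j <= K)%N by rewrite -total (bigD1 j) //= leq_addr.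
pose z : {ffun 'I_m -> 'I_K.+1} := [ffun j => inord (y j * len j)].
have zE j : z j = (y j * len j)%N :> nat by rewrite ffunE inordK ?ltnS ?y_le.
exists z; last by apply/rowP=> i; rewrite spreadE zE mulnK ?len_gt0 // xy.
apply/ptsP; split=> [j _|j|S _|]; rewrite ?inE //.
- by rewrite zE dvdn_mull.
- under eq_bigr do rewrite zE.
  rewrite -(ler_nat R) sum_y /clique_fun natrM ler_pM2l ?ltr0n //.
  have -> : mass len S = #|[set i | cyc i \in S]%SET|.
    by rewrite /mass -card_cyc; apply: eq_card => i; rewrite !inE.
  rewrite (le_trans (permutahedron_tri_le _ pP)) // le_eqVlt; apply/orP; left.
  by apply/eqP/eq_bigl => i; rewrite inE.
- transitivity (\sum_j y j * len j)%N; last by rewrite clique_fun_len_setT.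
  by apply: eq_big => [j|j _]; rewrite ?inE.
Qed.

Lemma spread_inj : {in cycle_points &, injective spread}.
Proof.
move=> z1 z2 /ptsP[dz1 _ _ _] /ptsP[dz2 _ _ _] e.
apply/ffunP=> j; apply: val_inj => /=.
have := len_gt0 j; rewrite lenE => /card_gt0P[i]; rewrite inE => /eqP <-.
have := congr1 (fun x : 'rV[R]_n => x 0 i) e.
rewrite !spreadE => /eqP; rewrite eqr_nat => /eqP e'.
by rewrite -(divnK (dz1 (cyc i) (finset.in_setT _))) e' divnK ?dz2 ?inE.
Qed.

Theorem card_lattice_points :
  finite_set (lattice_points t (fixed_permutahedron R s)) /\
  lattice_count t (fixed_permutahedron R s) = #|cycle_points|.
Proof.
apply: card_fset_set_injective spread_inj _ => x; split.
  exact: lattice_point_spread.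
by move=> [z zP ->]; apply: spread_lattice_point.
Qed.

End FixedPoints.

(** * The cycles of a permutation *)

Section CycleIndex.
Import mathcomp.boot.fintype mathcomp.boot.finset.
Variables (n : nat) (s : 'S_n).

Definition sorted_cycles : seq {set 'I_n} :=
  sort (relpre (fun C : {set 'I_n} => #|C|) geq) (enum (porbits s)).

Lemma cycle_typeE : cycle_type s = [seq #|C| | C : {set 'I_n} <- sorted_cycles].
Proof. exact: sort_map. Qed.

Lemma mem_sorted_cycles C : (C \in sorted_cycles) = (C \in porbits s).
Proof. by rewrite mem_sort mem_enum. Qed.

Lemma cycle_index_subproof i : (index (porbit s i) sorted_cycles < size (cycle_type s))%N.
Proof. by rewrite cycle_typeE size_map index_mem mem_sorted_cycles imset_f. Qed.

Lemma ltn_sorted_cycles (j : 'I_(size (cycle_type s))) : (j < size sorted_cycles)%N.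
Proof. by have := ltn_ord j; rewrite [X in (_ < X)%N](congr1 size cycle_typeE) size_map. Qed.

Definition cycle_index (i : 'I_n) : 'I_(size (cycle_type s)) := Ordinal (cycle_index_subproof i).

Lemma cycle_index_eq i j :
  (cycle_index i == j) = (i \in nth set0 sorted_cycles j).
Proof.
have u : uniq sorted_cycles by rewrite sort_uniq enum_uniq.
have : nth set0 sorted_cycles j \in porbits s.
  by rewrite -mem_sorted_cycles mem_nth ?ltn_sorted_cycles.
case/imsetP=> k _ kE; rewrite kE -eq_porbit_mem -val_eqE /= -kE.
apply/eqP/eqP => [<-|->]; last by rewrite index_uniq ?ltn_sorted_cycles.
by rewrite nth_index // mem_sorted_cycles imset_f.
Qed.

Lemma card_cycle_index j : part j = #|[pred i | cycle_index i == j]|.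
Proof.
rewrite /part {1}cycle_typeE (nth_map set0) ?ltn_sorted_cycles //.
by apply: eq_card => i; rewrite inE cycle_index_eq.
Qed.

Lemma part_gt0 (j : 'I_(size (cycle_type s))) : (0 < part j)%N.
Proof.
have : nth set0 sorted_cycles j \in porbits s.
  by rewrite -mem_sorted_cycles mem_nth ?ltn_sorted_cycles.
case/imsetP=> k _ kE; rewrite card_cycle_index; apply/card_gt0P; exists k.
by rewrite inE cycle_index_eq kE porbit_id.
Qed.

Lemma cycle_index_fixed (R : realType) (x : 'rV[R]_n) :
  perm_act s x = x <-> (forall i i', cycle_index i = cycle_index i' -> x 0 i = x 0 i').
Proof.
split=> [fix_x i i' /(congr1 val) /= e|H].
  have orbit_eq : porbit s i = porbit s i'.
    have mem k : porbit s k \in sorted_cycles by rewrite mem_sorted_cycles imset_f.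
    by rewrite -(nth_index set0 (mem i)) e nth_index.
  have : i \in porbit s i' by rewrite -orbit_eq porbit_id.
  case/porbitP=> k ->; elim: k => [|k IH]; first by rewrite expg0 perm1.
  by rewrite expgSr permM -IH -[in RHS]fix_x mxE.
apply/rowP=> i; rewrite mxE; apply: H; apply: val_inj => /=.
by congr index; have := porbit_perm s 1 i; rewrite expg1.
Qed.

End CycleIndex.

Theorem theorem1p1 (R : realType) (n : nat) (s : 'S_n) (t : nat) :
  (0 < n)%N -> (0 < t)%N ->
  let l := cycle_type s in
  let m := size l in
  finite_set (lattice_points t (fixed_permutahedron R s)) /\
  (lattice_count t (fixed_permutahedron R s))%:R =
    (if ~~ odd t then
       \sum_(P : {set {set 'I_m}} | finset.partition P [set: 'I_m]%SET)
         vcoef P * t%:R ^+ (m - #|P|)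
     else
       \sum_(P : {set {set 'I_m}} | finset.partition P [set: 'I_m]%SET && compatible P)
         vcoef P * t%:R ^+ (m - #|P|)) :> rat.
Proof.
move=> _ t_gt0 l m.
have lenE := @card_cycle_index n s; have len_gt0 := @part_gt0 n s.
have [fin ->] := card_lattice_points t_gt0 lenE len_gt0 (@cycle_index_fixed n s R).
split; first exact: fin.
rewrite card_clique_pts //; last by rewrite (clique_fun_len_setT t lenE).
exact: partition_sum_block_term.
Qed.
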